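(* Assume $\mathbb E[\xi+\xi^{-1}+\nu^2]<\infty$. Then, almost surely, $$\frac{C_n}{\mathbb E[C_n]}\longrightarrow W \qquad\text{as } n\to\infty,$$ where $W=\lim_{n\to\infty} m^{-n}\#\mathbb T_n$.
   Context: Let $\mathbf p=(p_k)_{k\ge0}$ be a probability distribution on the nonnegative integers with $p_0=0$ and finite mean $m=\sum_k kp_k>1$. Let $\mathbb T$ be a Galton–Watson tree with offspring distribution $\mathbf p$, rooted at $\varnothing$, and let $\nu$ denote the number of children of the root (so $\nu\sim\mathbf p$). For a vertex $x$, $|x|$ is its depth (graph distance to the root) and $\overleftarrow{x}$ its parent (if $x\ne\varnothing$). Let $\mathbb T_n=\{x\in\mathbb T:|x|=n\}$. The depth of the edge $e=\{\overleftarrow x,x\}$ is $d(e)=|x|$. Let $\xi$ be a strictly positive random variable; conditionally on $\mathbb T$, let $\{\xi(e)\}$ be i.i.d. copies of $\xi$ indexed by the edges of $\mathbb T$, and assign to each edge $e$ the resistance $r(e)=m^{d(e)}\xi(e)$ (conductance $1/r(e)$). $C_n$ denotes the effective conductance, in this electric network, between the root $\varnothing$ and the set $\mathbb T_n$. It is known that $m^{-n}\#\mathbb T_n$ converges almost surely (and in $L^2$ when $\mathbb E[\nu^2]<\infty$) to a limit $W$, which is a.s. strictly positive with $\mathbb E[W]=1$. *)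

(* Defs.v *)
From HB Require Import structures.
From mathcomp Require Import all_boot all_order all_algebra.
From mathcomp Require Import all_classical all_reals all_analysis.
Set Implicit Arguments. Unset Strict Implicit. Unset Printing Implicit Defensive.
Import Order.TTheory GRing.Theory Num.Theory.
Import numFieldNormedType.Exports.
Local Open Scope classical_set_scope.
Local Open Scope ring_scope.

(* Ulam--Harris labelling: a vertex is a list of nats; the list [i :: u]
   denotes the i-th child (i = 0,1,...) of the vertex u; the root is [::].
   So |u| = size u and the parent of u is behead u. *)

Fixpoint level (N : seq nat -> nat) (k : nat) : seq (seq nat) :=
  match k with
  | 0 => [:: [::]]
  | k.+1 => flatten [seq [seq i :: u | i <- iota 0 (N u)] | u <- level N k]
  end.

Definition energy {R : realType} (N : seq nat -> nat) (c : seq nat -> R)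
    (n : nat) (f : seq nat -> R) : R :=
  \sum_(k < n) \sum_(u <- level N k.+1) c u * (f (behead u) - f u) ^+ 2.

(* Effective conductance between the root and the set of depth-n vertices
   (Dirichlet principle definition: infimum of the energy over all
   potentials equal to 1 at the root and 0 on the depth-n vertices). *)
Definition eff_conductance {R : realType} (N : seq nat -> nat)
    (c : seq nat -> R) (n : nat) : R :=
  inf [set energy N c n f | f in
        [set f : seq nat -> R | f [::] = 1 /\ forall u, u \in level N n -> f u = 0]].

Definition mutually_independent {d} {T : measurableType d} {R : realType}
    (P : probability T R) (I : eqType) (X : I -> T -> R) : Prop :=
  forall (s : seq I) (B : I -> set R), uniq s -> (forall i, measurable (B i)) ->
    P (\big[setI/setT]_(i <- s) (X i @^-1` B i)) =
    (\prod_(i <- s) P (X i @^-1` B i))%E.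

(* Main.v *)
(* Cutting the tree at the root gives [C_(n+1) = average of C_n / (1 + xi C_n)]
   over the branches, where [average f = m^-1 * (sum of f over the branches)] has
   the same mean as [f], and second moment [E f^2 / m + B (E f)^2].  From this,
   with [c_n = E C_n]: the variational form of the series law gives
   [c_n <= E xi^-1 / n], the uniform flow and Thomson's principle give
   [c_n >= const / n], and then [E C_n^2 <= const * c_n^2] and
   [c_n - c_(n+1) <= E xi * E C_n^2 <= const * c_n / n].

   Let [A] be the average over depth [k] of the copies of [C_n].  Conditionally on
   the first [k] levels, [A / c_n] is [#T_k / m^k] up to a variance [O(m^-k)], and
   [A >= C_(n+k)] with [E (A - C_(n+k)) = c_n - c_(n+k) = O(k c_n / n)].  Both
   errors are summable along [n = k^3], so that [C_N / c_N -> W] almost surely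
   along [N = k^3 + k - 1]; monotonicity of [C] and [c] fills the gaps because
   [c] varies by a factor tending to 1 between consecutive such [N]. *)
Require Import Defs.
From HB Require Import structures.
From mathcomp Require Import all_boot all_order all_algebra.
From mathcomp Require Import all_classical all_reals all_analysis.
From mathcomp Require Import measurable_realfun zify ring lra.
Set Implicit Arguments.
Unset Strict Implicit.
Unset Printing Implicit Defensive.
Import Order.TTheory GRing.Theory Num.Theory.
Import numFieldNormedType.Exports.
Local Open Scope classical_set_scope.
Local Open Scope ring_scope.

(** No conditional expectation is formed. Every quantity is a functional of the whole family
    [w : idx -> R], and its measurability with respect to a set of coordinates records what it
    reads; independence of two branches, or of an edge and the subtree below it, comes from disjoint
    coordinate sets. Conditioning on the first [k] levels becomes [k] applications of [average],
    with exact recursions for first and second moments; [m > 1] enters as the contraction factor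
    [1 / m] in the second one. The cube is a compromise. At depth [k^j] the relative gap in mean is
    of order [k / k^j], which is not summable for [j = 2]; a geometric sequence of depths would be
    too sparse for the interpolation, since [c_n] is of order [1 / n]. *)

(** * Independence on generated sigma-algebras *)

Section independence.
Context {d : measure_display} {T : measurableType d} {R : realType}.
Variable P : probability T R.

(** As functions of [A], both sides are finite measures; they agree on the pi-system [G], hence on
    what it generates. *)
Lemma indep_g_sigma_algebra (U : pointedType) (G : set (set U))
    (phi : T -> g_sigma_algebraType G) (E : set T) :
  setI_closed G -> G setT -> measurable_fun setT phi -> measurable E ->
  (forall A, G A -> P (phi @^-1` A `&` E) = (P (phi @^-1` A) * P E)%E) ->
  forall A : set (g_sigma_algebraType G), measurable A ->
    P (phi @^-1` A `&` E) = (P (phi @^-1` A) * P E)%E.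
Proof.
move=> GI GT mphi mE H A mA.
pose phi' : {mfun T >-> g_sigma_algebraType G} := HB.pack phi
  (isMeasurableFun.Build _ _ _ _ phi mphi).
have PE0 : 0 <= fine (P E) by rewrite fine_ge0.
have [m1 m1E] : exists m1 : {measure set (g_sigma_algebraType G) -> \bar R},
    m1 = pushforward (mrestr P mE) phi :> (_ -> _).
  by exists (measure_function_pushforward__canonical__measure_function_Measure
    (mrestr P mE) mphi).
pose m2 : {measure set (g_sigma_algebraType G) -> \bar R} :=
  mscale (NngNum PE0) (distribution P phi').
have m2E B : m2 B = (P E * P (phi @^-1` B))%E.
  rewrite [LHS](_ : _ = (fine (P E))%:E * P (phi @^-1` B))%E//.
  by rewrite fineK ?fin_num_measure.
suff: m1 A = m2 A.
  by rewrite m1E m2E /pushforward /mrestr muleC.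
apply: (@measure_unique _ R (g_sigma_algebraType G) G (fun=> setT) _ _ _ _ m1 m2) => //.
- by rewrite bigcup_const//.
- move=> B GB; rewrite m1E m2E /pushforward /mrestr muleC.
  exact: H.
- move=> k; rewrite m1E /pushforward /mrestr /= setTI.
  by rewrite ltey_eq fin_num_measure.
Qed.

Lemma indep_g_sigma_algebra2 (U1 U2 : pointedType)
    (G1 : set (set U1)) (G2 : set (set U2))
    (phi1 : T -> g_sigma_algebraType G1) (phi2 : T -> g_sigma_algebraType G2) :
  setI_closed G1 -> G1 setT -> measurable_fun setT phi1 ->
  setI_closed G2 -> G2 setT -> measurable_fun setT phi2 ->
  (forall A B, G1 A -> G2 B -> P (phi1 @^-1` A `&` phi2 @^-1` B) =
     (P (phi1 @^-1` A) * P (phi2 @^-1` B))%E) ->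
  forall (A : set (g_sigma_algebraType G1)) (B : set (g_sigma_algebraType G2)),
    measurable A -> measurable B ->
    P (phi1 @^-1` A `&` phi2 @^-1` B) = (P (phi1 @^-1` A) * P (phi2 @^-1` B))%E.
Proof.
move=> G1I G1T m1 G2I G2T m2 H A B mA mB.
apply: indep_g_sigma_algebra => //.
  by rewrite -[X in measurable X]setTI; exact: m2.
move=> {mA} {}A GA; rewrite setIC muleC.
apply: indep_g_sigma_algebra => //.
  by rewrite -[X in measurable X]setTI; apply: m1 => //; exact: sub_sigma_algebra.
by move=> B' GB'; rewrite setIC muleC; exact: H.
Qed.

(** The joint law is the product of the laws, so Tonelli applies; with nonnegative variables no
    integrability is required. *)
Lemma ge0_integral_indepM (X Y : T -> R) :
  measurable_fun setT X -> measurable_fun setT Y ->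
  (forall w, 0 <= X w) -> (forall w, 0 <= Y w) ->
  (forall A B, measurable A -> measurable B ->
    P (X @^-1` A `&` Y @^-1` B) = (P (X @^-1` A) * P (Y @^-1` B))%E) ->
  (\int[P]_w (X w * Y w)%:E = \int[P]_w (X w)%:E * \int[P]_w (Y w)%:E)%E.
Proof.
move=> mX mY X0 Y0 XY.
pose X' : {mfun T >-> R} := HB.pack X (isMeasurableFun.Build _ _ _ _ X mX).
pose Y' : {mfun T >-> R} := HB.pack Y (isMeasurableFun.Build _ _ _ _ Y mY).
have mXY : measurable_fun setT (fun w => (X w, Y w)) by exact/measurable_fun_pair.
pose XY' : {mfun T >-> (R * R)%type} := HB.pack (fun w => (X w, Y w))
  (isMeasurableFun.Build _ _ _ _ _ mXY).
pose mu1 : probability R R := distribution P X'.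
pose mu2 : probability R R := distribution P Y'.
(* The absolute values make the integrand nonnegative on the whole plane, as Tonelli demands, and
   change nothing along [X] and [Y]. *)
pose f : R * R -> \bar R := fun z => (`|z.1| * `|z.2|)%:E.
have mf : measurable_fun setT f.
  apply/measurable_EFinP; apply: measurable_funM.
    by apply: measurableT_comp => //; exact: measurable_fst.
  by apply: measurableT_comp => //; exact: measurable_snd.
have f0 z : (0 <= f z)%E by rewrite lee_fin mulr_ge0.
have -> : (\int[P]_w (X w * Y w)%:E = \int[distribution P XY']_z f z)%E.
  rewrite ge0_integral_distribution//.
  by apply: eq_integral => w _; rewrite /f /= !ger0_norm.
have -> : (\int[distribution P XY']_z f z = \int[mu1 \x mu2]_z f z)%E.
  apply: eq_measure_integral => A mA _; apply/esym.
  by apply: product_measure_unique => // B C mB mC; rewrite -XY.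
rewrite (fubini_tonelli1 f)//.
have mn : measurable_fun setT (fun x : R => `|x|%:E).
  by apply/measurable_EFinP; exact: normr_measurable.
have nn (x : R) : (0 <= `|x|%:E)%E by rewrite lee_fin.
have e1 : (\int[mu1]_x `|x|%:E = \int[P]_w (X w)%:E)%E.
  rewrite ge0_integral_distribution//.
  by apply: eq_integral => w _; rewrite /= ger0_norm.
have e2 : (\int[mu2]_x `|x|%:E = \int[P]_w (Y w)%:E)%E.
  rewrite ge0_integral_distribution//.
  by apply: eq_integral => w _; rewrite /= ger0_norm.
rewrite -e1 -e2 /fubini_F.
under eq_integral => x _.
  rewrite /f /=; under eq_integral => y _ do rewrite EFinM.
  rewrite ge0_integralZl//.
  over.
by rewrite ge0_integralZr// integral_ge0.
Qed.

End independence.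

(** * Sigma-algebras generated by sets of coordinates *)

Section cylinders.
Context {R : realType} {I : choiceType}.

Definition cylinder (s : seq I) (B : I -> set R) : set (I -> R) :=
  [set w | forall i, i \in s -> B i (w i)].

Definition cylinders (J : set I) : set (set (I -> R)) :=
  [set A | exists s (B : I -> set R), [/\ uniq s, forall i, i \in s -> J i,
     forall i, measurable (B i) & A = cylinder s B]].

Lemma cylinders_setT J : cylinders J setT.
Proof.
by exists [::], (fun=> setT); split => //; apply/seteqP; split.
Qed.

Lemma cylinders_setI J : setI_closed (cylinders J).
Proof.
move=> _ _ [s [B [us sJ mB ->]]] [s' [B' [us' s'J mB' ->]]].
exists (undup (s ++ s')), (fun i => (if i \in s then B i else setT) `&`
  (if i \in s' then B' i else setT)); split.
- exact: undup_uniq.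
- by move=> i; rewrite mem_undup mem_cat => /orP[/sJ|/s'J].
- by move=> i; apply: measurableI; case: ifP.
apply/seteqP; split => w /=.
  by move=> [h h'] i _; split; case: ifP => //; [exact: h|exact: h'].
by move=> h; split=> i i_s; have := h i; rewrite mem_undup mem_cat i_s ?orbT;
  move=> /(_ isT)[].
Qed.

(** The carrier is always the full product; only the sigma-algebra depends on [J]. Thus
    measurability on [cylT J] expresses that a functional reads only the coordinates in [J]. *)
Definition cylT (J : set I) := g_sigma_algebraType (cylinders J).

Lemma measurable_coord (J : set I) i : J i ->
  measurable_fun setT (fun w : cylT J => w i).
Proof.
move=> Ji _ B mB; rewrite setTI; apply: sub_sigma_algebra.
exists [:: i], (fun=> B); split => //.
- by move=> j; rewrite inE => /eqP ->.
apply/seteqP; split => w /=.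
  by move=> ? j; rewrite inE => /eqP ->.
by apply; rewrite inE.
Qed.

Lemma measurable_to_cylT d (T : measurableType d) (J : set I)
    (phi : T -> cylT J) :
  (forall i, J i -> measurable_fun setT (fun w => phi w i)) ->
  measurable_fun setT phi.
Proof.
move=> mphi; apply: measurability => // _ [_ [s [B [us sJ mB ->]]] <-].
rewrite setTI (_ : _ @^-1` _ =
    \bigcap_(i in [set` s]) ((fun w => phi w i) @^-1` B i)); last first.
  by apply/seteqP; split => w.
rewrite bigcap_seq big_seq; apply: bigsetI_measurable => i i_s.
by rewrite -[X in measurable X]setTI; apply: mphi => //; exact: sJ.
Qed.

Lemma measurable_reindex (J K : set I) (tau : I -> I) :
  (forall i, K i -> J (tau i)) ->
  measurable_fun setT (fun w : cylT J => (w \o tau) : cylT K).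
Proof.
move=> KJ; apply: measurable_to_cylT => i Ki.
exact: (measurable_coord (KJ _ Ki)).
Qed.

Lemma sub_measurable_cylT d (U : measurableType d) (J K : set I)
    (f : (I -> R) -> U) : J `<=` K ->
  measurable_fun setT (f : cylT J -> U) -> measurable_fun setT (f : cylT K -> U).
Proof.
move=> JK mf; apply: (measurableT_comp mf (@measurable_reindex K J id _)).
exact: JK.
Qed.

End cylinders.

(** * Independent families: disjoint coordinates and relabelling *)

Section independent_process.
Context {d : measure_display} {T : measurableType d} {R : realType}.
Context {I : choiceType} (P : probability T R) (X : I -> T -> R).
Hypothesis mX : forall i, measurable_fun setT (X i).
Hypothesis iX : mutually_independent P X.

Definition sample (w : T) : I -> R := X^~ w.

Lemma measurable_sample (J : set I) (tau : I -> I) :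
  measurable_fun setT (fun w => (sample w \o tau) : cylT J).
Proof. by apply: measurable_to_cylT => i _; exact: mX. Qed.

Lemma preimage_sample_cylinder (tau : I -> I) s (B : I -> set R) :
  (fun w => sample w \o tau) @^-1` cylinder s B =
  \big[setI/setT]_(i <- s) (X (tau i) @^-1` B i).
Proof. by rewrite -bigcap_seq; apply/seteqP; split. Qed.

Let preimage_cylinder s (B : I -> set R) :
  sample @^-1` cylinder s B = \big[setI/setT]_(i <- s) (X i @^-1` B i).
Proof. exact: (preimage_sample_cylinder id). Qed.

Lemma indep_sample (J K : set I) (A : set (cylT J)) (B : set (cylT K)) :
  J `&` K = set0 -> measurable A -> measurable B ->
  P (sample @^-1` A `&` sample @^-1` B) =
    (P (sample @^-1` A) * P (sample @^-1` B))%E.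
Proof.
move=> JK mA mB; apply: (@indep_g_sigma_algebra2 _ _ _ P _ _ (cylinders J)
  (cylinders K) sample sample) => //; do 1?[exact: cylinders_setI|
  exact: cylinders_setT|exact: (@measurable_sample _ id)].
move=> {mA mB A B} _ _ [s [A [us sJ mA ->]]] [s' [B [us' s'K mB ->]]].
have ss' i : i \in s -> i \in s' -> False.
  by move=> /sJ Ji /s'K Ki; have : (J `&` K) i by []; rewrite JK.
rewrite !preimage_cylinder.
(* The two lists are disjoint, so one family of constraints serves both and [iX] applies to their
   concatenation. *)
pose D i := if i \in s then A i else B i.
have mD i : measurable (D i) by rewrite /D; case: ifP.
have eA : \big[setI/setT]_(i <- s) (X i @^-1` A i) =
          \big[setI/setT]_(i <- s) (X i @^-1` D i).
  by rewrite !big_seq; apply: eq_bigr => i i_s; rewrite /D i_s.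
have eB : \big[setI/setT]_(i <- s') (X i @^-1` B i) =
          \big[setI/setT]_(i <- s') (X i @^-1` D i).
  rewrite !big_seq; apply: eq_bigr => i i_s'; rewrite /D; case: ifP => // /ss'.
  by move=> /(_ i_s').
rewrite eA eB -big_cat /= !iX//; first by rewrite big_cat.
rewrite cat_uniq us us' andbT /=; apply/hasPn => i i_s'; apply/negP => i_s.
exact: ss' i_s i_s'.
Qed.

(** By independence a cylinder probability is a product of marginals; an injective relabelling that
    preserves the marginals preserves this product. *)
Lemma law_sample (J K : set I) (tau : I -> I) (A : set (cylT K)) :
  {in K &, injective tau} ->
  (forall i B, measurable B -> P (X (tau i) @^-1` B) = P (X i @^-1` B)) ->
  measurable A ->
  P ((fun w => sample w \o tau) @^-1` A) = P (sample @^-1` A).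
Proof.
move=> itau etau mA.
pose f1 : {mfun T >-> cylT K} := HB.pack (fun w => (sample w \o tau) : cylT K)
  (isMeasurableFun.Build _ _ _ _ _ (@measurable_sample K tau)).
pose f2 : {mfun T >-> cylT K} := HB.pack (sample : T -> cylT K)
  (isMeasurableFun.Build _ _ _ _ _ (@measurable_sample K id)).
pose m1 : probability (cylT K) R := distribution P f1.
pose m2 : probability (cylT K) R := distribution P f2.
suff: m1 A = m2 A by [].
apply: (@measure_unique _ R (cylT K) (cylinders K) (fun=> setT)
  _ _ _ _ m1 m2) => //.
- exact: cylinders_setI.
- by move=> _; exact: cylinders_setT.
- by rewrite bigcup_const.
- move=> _ [s [B [us sK mB ->]]]; 
  rewrite [LHS](_ : _ = P ((fun w => sample w \o tau) @^-1` cylinder s B))//.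
  rewrite [RHS](_ : _ = P (sample @^-1` cylinder s B))//.
  rewrite preimage_sample_cylinder preimage_cylinder iX//.
  (* [g] inverts [tau] on [s], so that the constraints can be indexed by the relabelled list. *)
  pose g j := nth j s (index j (map tau s)).
  have gE i : i \in s -> g (tau i) = i.
    move=> i_s; have jm : tau i \in map tau s by rewrite map_f.
    have lt : (index (tau i) (map tau s) < size s)%N by rewrite -(size_map tau) index_mem.
    have := nth_index (tau i) jm; rewrite (nth_map (tau i))// -/(g (tau i)).
    apply: itau; rewrite inE; apply: sK => //.
    exact: mem_nth.
  transitivity (P (\big[setI/setT]_(j <- map tau s) (X j @^-1` B (g j)))).
    by rewrite big_map; congr (P _); apply: eq_big_seq => i /gE ->.
  rewrite iX//; last first.
    by rewrite map_inj_in_uniq// => i j /sK Ki /sK Kj; apply: itau; rewrite inE.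
  rewrite big_map; apply: eq_big_seq => i /gE ->.
  exact: etau.
- by move=> k; rewrite ltey_eq fin_num_measure.
Qed.

Local Notation ex f := (\int[P]_w (f (sample w))%:E)%E.

Lemma ex_indepM (J K : set I) (f g : (I -> R) -> R) :
  J `&` K = set0 ->
  measurable_fun setT (f : cylT J -> R) -> measurable_fun setT (g : cylT K -> R) ->
  (forall w, 0 <= f w) -> (forall w, 0 <= g w) ->
  (ex (f \* g) = ex f * ex g)%E.
Proof.
move=> JK mf mg f0 g0; apply: ge0_integral_indepM => //.
- exact: (measurableT_comp mf (@measurable_sample J id)).
- exact: (measurableT_comp mg (@measurable_sample K id)).
move=> A B mA mB; apply: (@indep_sample J K (f @^-1` A) (g @^-1` B)) => //.
- by rewrite -[X in measurable X]setTI; exact: mf.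
- by rewrite -[X in measurable X]setTI; exact: mg.
Qed.

Lemma ex_reindex (K : set I) (tau : I -> I) (f : (I -> R) -> R) :
  {in K &, injective tau} ->
  (forall i B, measurable B -> P (X (tau i) @^-1` B) = P (X i @^-1` B)) ->
  measurable_fun setT (f : cylT K -> R) -> (forall w, 0 <= f w) ->
  ex (fun w => f (w \o tau)) = ex f.
Proof.
move=> itau etau mf f0.
pose f1 : {mfun T >-> cylT K} := HB.pack (fun w => (sample w \o tau) : cylT K)
  (isMeasurableFun.Build _ _ _ _ _ (@measurable_sample K tau)).
pose f2 : {mfun T >-> cylT K} := HB.pack (sample : T -> cylT K)
  (isMeasurableFun.Build _ _ _ _ _ (@measurable_sample K id)).
have mf' : measurable_fun setT (EFin \o (f : cylT K -> R)) by apply/measurable_EFinP.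
have h (g : {mfun T >-> cylT K}) :
    (\int[distribution P g]_y (f y)%:E = \int[P]_w (f (g w))%:E)%E.
  by rewrite ge0_integral_distribution// => y; rewrite lee_fin.
rewrite -(h f1) -(h f2); apply: eq_measure_integral => A mA _.
exact: law_sample.
Qed.

End independent_process.

(* [inl u] indexes the number of children of [u], [inr u] the resistance factor of
   the edge above [u]; at the root, [inr [::]] is free for the edge through which a
   subtree is attached to its parent. *)
Notation idx := (seq nat + seq nat)%type.

(** * Branches and averages over them *)

Section branching.
Context {R : realType}.
Implicit Types (w : idx -> R) (f g : (idx -> R) -> R).

(** The head of a label is its latest generation, so the ancestor in the first generation is the
    last entry; hence [rcons]. *)
Definition branch (i : nat) (j : idx) : idx :=
  match j with inl u => inl (rcons u i) | inr u => inr (rcons u i) end.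

Definition subtree (i : nat) w : idx -> R := w \o branch i.

Definition nu w : nat := Num.truncn (w (inl [::])).

(* The absolute value makes all functionals nonnegative on the whole of
   [idx -> R], not only on the samples. *)
Definition edge w : R := `|w (inr [::])|.

Definition average (m : R) f w : R := m^-1 * \sum_(i < nu w) f (subtree i w).

Lemma branch_inj i : injective (branch i).
Proof. by case=> u; case=> v //= [/rcons_inj[->]]. Qed.

Lemma branch_disj i j u v : branch i u = branch j v -> i = j.
Proof. by case: u v => u; case=> v //= [/rcons_inj[]]. Qed.

Lemma branch_neq_inl i u : branch i u <> inl [::].
Proof. by case: u => //= -[]. Qed.

Lemma branch_neq_inr i u : branch i u <> inr [::].
Proof. by case: u => //= -[]. Qed.

Lemma edge_ge0 w : 0 <= edge w.
Proof. exact: normr_ge0. Qed.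

Lemma average_ge0 m f w : 0 < m -> (forall v, 0 <= f v) -> 0 <= average m f w.
Proof.
by move=> m0 f0; apply: mulr_ge0; [rewrite invr_ge0 ltW|exact: sumr_ge0].
Qed.

Lemma measurable_inv d (T : measurableType d) (f : T -> R) :
  measurable_fun setT f -> (forall x, 0 <= f x) ->
  measurable_fun setT (fun x => (f x)^-1).
Proof.
move=> mf f0; rewrite (_ : (fun _ => _) = (fun x => f x `^ (-1))).
  by apply: (@measurableT_comp _ _ _ _ _ _ (fun x : R => x `^ (-1))); [exact: measurable_powR|exact: mf].
by apply/funext => x; rewrite powR_inv1.
Qed.

Section measurability.
Variable J : set idx.
Hypothesis Jroot : J (inl [::]).

Lemma measurable_nu_eq k : measurable [set w : cylT J | nu w = k].
Proof.
have mle n : measurable [set w : cylT J | (nu w <= n)%N].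
  rewrite (_ : mkset _ =
      (fun w : cylT J => w (inl [::])) @^-1` `]-oo, n.+1%:R[%classic); last first.
    by apply/seteqP; split => w /=; rewrite /nu truncn_le_nat in_itv.
  rewrite -[X in measurable X]setTI.
  by apply: (measurable_coord Jroot) => //; exact: measurable_itv.
case: k => [|k].
  rewrite (_ : mkset _ = [set w : cylT J | (nu w <= 0)%N])//.
  by apply/seteqP; split => w /= => [->//|]; rewrite leqn0 => /eqP.
rewrite (_ : mkset _ = [set w : cylT J | (nu w <= k.+1)%N] `\`
  [set w : cylT J | (nu w <= k)%N]); first exact: measurableD.
apply/seteqP; split => w /= => [->|]; first by split => //; rewrite ltnn.
by move=> []; lia.
Qed.

Lemma measurable_nu_dep d (U : measurableType d) (G : nat -> (idx -> R) -> U) :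
  (forall k, measurable_fun setT (G k : cylT J -> U)) ->
  measurable_fun setT ((fun w => G (nu w) w) : cylT J -> U).
Proof.
move=> mG; rewrite (_ : setT = \bigcup_k [set w : cylT J | nu w = k]); last first.
  by apply/seteqP; split => // w _; exists (nu w).
apply/measurable_fun_bigcup => [k|k]; first exact: measurable_nu_eq.
apply: (@eq_measurable_fun _ _ (cylT J) U [set w : cylT J | nu w = k] (G k)).
  by move=> w; rewrite inE /= => ->.
exact: measurable_funTS.
Qed.

(** An average reads the number of children of the root and the branches, but never [inr [::]].
    Keeping track of [J] is what later makes a subtree independent of the edge above it. *)
Lemma measurable_average m (K : set idx) f :
  (forall i u, K u -> J (branch i u)) ->
  measurable_fun setT (f : cylT K -> R) ->
  measurable_fun setT (average m f : cylT J -> R).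
Proof.
move=> KJ mf; apply: measurable_funM => //.
apply: (@measurable_nu_dep _ _ (fun k w => \sum_(i < k) f (subtree i w))) => k.
apply: measurable_sum => i.
exact: (measurableT_comp mf (measurable_reindex (KJ i))).
Qed.

End measurability.

Lemma measurable_averageT m f :
  measurable_fun setT (f : cylT setT -> R) ->
  measurable_fun setT (average m f : cylT setT -> R).
Proof. exact: measurable_average. Qed.

Lemma measurable_edge J : J (inr [::]) ->
  measurable_fun setT (edge : cylT J -> R).
Proof. by move=> Jr; apply: (measurableT_comp (@normr_measurable _ _) (measurable_coord Jr)). Qed.

End branching.

(** * First and second moments of an average *)

Section branching_moments.
Context {d : measure_display} {T : measurableType d} {R : realType}.
Context (P : probability T R) (X : idx -> T -> R) (p : nat -> R) (m b : R).
Hypothesis mX : forall i, measurable_fun setT (X i).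
Hypothesis iX : mutually_independent P X.
Hypothesis X_inl : forall u v B, measurable B ->
  P (X (inl u) @^-1` B) = P (X (inl v) @^-1` B).
Hypothesis X_inr : forall u v B, measurable B ->
  P (X (inr u) @^-1` B) = P (X (inr v) @^-1` B).
Hypothesis p_nu : forall k, P [set w | nu (sample X w) = k] = (p k)%:E.
Hypothesis m0 : 0 < m.
Hypothesis mean1 : (\sum_(k <oo) (k%:R * p k)%:E = m%:E)%E.
Hypothesis mean2 : (\sum_(k <oo) ((k * k.-1)%:R * p k)%:E = b%:E)%E.

Notation ex f := (\int[P]_w (f (sample X w))%:E)%E.

Lemma p_ge0 k : 0 <= p k.
Proof. by rewrite -lee_fin -p_nu measure_ge0. Qed.

Lemma ex_ge0 (f : (idx -> R) -> R) : (forall w, 0 <= f w) -> (0 <= ex f)%E.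
Proof. by move=> f0; apply: integral_ge0 => w _; rewrite lee_fin. Qed.

Lemma measurable_ex (f : (idx -> R) -> R) (J : set idx) :
  measurable_fun setT (f : cylT J -> R) ->
  measurable_fun setT (fun w => (f (sample X w))%:E).
Proof.
move=> mf; apply/measurable_EFinP.
exact: (measurableT_comp mf (measurable_sample mX (J := J) id)).
Qed.

Lemma ex_subtree i (f : (idx -> R) -> R) :
  measurable_fun setT (f : cylT setT -> R) -> (forall w, 0 <= f w) ->
  ex (fun w => f (subtree i w)) = ex f.
Proof.
move=> mf f0; apply: (@ex_reindex _ _ _ _ P X mX iX setT (branch i) f) => //.
  by move=> ? ? _ _; exact: branch_inj.
by case=> u B mB; [exact: X_inl|exact: X_inr].
Qed.

Lemma measurable_subtree (f : (idx -> R) -> R) (J : set idx) i :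
  (forall u, J (branch i u)) -> measurable_fun setT (f : cylT setT -> R) ->
  measurable_fun setT ((fun w => f (subtree i w)) : cylT J -> R).
Proof.
by move=> Ji mf; apply: (measurableT_comp mf (measurable_reindex (J := J) _)).
Qed.

Lemma ex_subtreeM i j (f g : (idx -> R) -> R) :
  measurable_fun setT (f : cylT setT -> R) -> (forall w, 0 <= f w) ->
  measurable_fun setT (g : cylT setT -> R) -> (forall w, 0 <= g w) -> i != j ->
  ex (fun w => f (subtree i w) * g (subtree j w)) = (ex f * ex g)%E.
Proof.
move=> mf f0 mg g0 ij.
rewrite (@ex_indepM _ _ _ _ P X mX iX (range (branch i)) (range (branch j))
  (fun w => f (subtree i w)) (fun w => g (subtree j w))) ?ex_subtree//.
- apply/seteqP; split => // u [[v _ <-]] [v' _ /branch_disj] ji.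
  by rewrite ji eqxx in ij.
- by apply: measurable_subtree => // u; exists u.
- by apply: measurable_subtree => // u; exists u.
Qed.

(** Split according to the value of [nu]: [G k] does not read the root's offspring count, so it is
    independent of the event [nu = k]. *)
Lemma ex_nu_dep (G : nat -> (idx -> R) -> R) :
  (forall k, measurable_fun setT (G k : cylT [set~ inl [::]] -> R)) ->
  (forall k w, 0 <= G k w) ->
  (ex (fun w => G (nu w) w) = \sum_(k <oo) (p k)%:E * ex (G k))%E.
Proof.
move=> mG G0.
pose F k := [set w | nu (sample X w) = k].
have mF k : measurable (F k).
  rewrite -[X in measurable X]setTI.
  have mk : measurable [set w : cylT setT | nu (w : idx -> R) = k].
    exact: measurable_nu_eq.
  exact: (measurable_sample mX id measurableT mk).
have UF : \bigcup_k F k = setT.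
  by apply/seteqP; split => // w _; exists (nu (sample X w)).
rewrite -[in LHS]UF ge0_integral_bigcup//=; last 3 first.
- rewrite UF; apply: (@measurable_ex (fun w => G (nu w) w) setT).
  by apply: measurable_nu_dep => // k; apply: (sub_measurable_cylT _ (mG k)).
- by move=> w _; rewrite lee_fin.
- by apply/trivIsetP => i j _ _ ij; apply/seteqP; split => // w []; rewrite /F /= => -> /eqP; exact/negP.
apply: eq_eseriesr => k _.
have mFk : measurable [set w : cylT [set inl [::]] | nu (w : idx -> R) = k].
  exact: measurable_nu_eq.
pose one (w : idx -> R) : R := (nu w == k)%:R.
have one1 : one = \1_[set w | nu w = k].
  apply/funext => w; rewrite indicE /one; congr (_%:R); congr nat_of_bool.
  by apply/eqP/idP; rewrite inE.
have mone : measurable_fun setT (one : cylT [set inl [::]] -> R).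
  by rewrite one1; exact: measurable_indic mFk.
have := @ex_indepM _ _ _ _ P X mX iX [set inl [::]] [set~ inl [::]] one (G k).
rewrite setICr => /(_ erefl mone (mG k)) h.
transitivity (ex (one \* G k)).
  rewrite integral_mkcond/=; apply: eq_integral => w _.
  rewrite patchE /= /one; case: ifPn; [rewrite inE|rewrite notin_setE]; rewrite /F /= => Fw.
    by rewrite Fw eqxx mul1r.
  by rewrite (_ : _ == k = false) ?mul0r//; exact/eqP.
rewrite h//; congr (_ * _)%E.
rewrite -p_nu -[in RHS](setIT [set w | _]) -integral_indic//; last exact: mF.
by apply: eq_integral => w _; rewrite one1 !indicE; congr (_%:R%:E).
Qed.

Lemma measurable_sum_subtree k (f : (idx -> R) -> R) (J : set idx) :
  (forall i u, J (branch i u)) ->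
  measurable_fun setT (f : cylT setT -> R) ->
  measurable_fun setT ((fun w => \sum_(i < k) f (subtree i w)) : cylT J -> R).
Proof. by move=> Jb mf; apply: measurable_sum => i; exact: measurable_subtree. Qed.

(** Shaped for sums over [k] branches: a product of two such sums has [k] diagonal terms and
    [k (k - 1)] off-diagonal ones. *)
Lemma moment_series (x y : R) : 0 <= x -> 0 <= y ->
  (\sum_(k <oo) (p k)%:E * (k%:R * x + (k * k.-1)%:R * y)%:E =
   (m * x + b * y)%:E)%E.
Proof.
move=> x0 y0.
transitivity (\sum_(k <oo) (x%:E * (k%:R * p k)%:E +
    y%:E * ((k * k.-1)%:R * p k)%:E))%E.
  by apply: eq_eseriesr => k _; rewrite -!EFinM -EFinD; congr EFin; ring.
rewrite nneseriesD; last 2 first.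
- by move=> k _ _; rewrite -EFinM lee_fin !mulr_ge0// p_ge0.
- by move=> k _ _; rewrite -EFinM lee_fin !mulr_ge0// p_ge0.
rewrite !nneseriesZl; last 2 first.
- by move=> k _; rewrite lee_fin mulr_ge0// p_ge0.
- by move=> k _; rewrite lee_fin mulr_ge0// p_ge0.
by rewrite mean1 mean2 -!EFinM -EFinD mulrC (mulrC y).
Qed.

Let mS k (f : (idx -> R) -> R) J : (forall i u, J (branch i u)) ->
  measurable_fun setT (f : cylT setT -> R) ->
  measurable_fun setT ((fun w => \sum_(i < k) f (subtree i w)) : cylT J -> R).
Proof. by move=> Jb mf; exact: measurable_sum_subtree. Qed.

Let S0 k (f : (idx -> R) -> R) w : (forall w, 0 <= f w) ->
  0 <= \sum_(i < k) f (subtree i w).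
Proof. by move=> f0; exact: sumr_ge0. Qed.

(** In the product of the two sums, a diagonal term has mean [z], and an off-diagonal one has mean
    [x * y] because distinct branches are independent. The bilinear form is needed for the cross
    moment of [A] and [S] below. *)
Lemma ex_averageM (f g : (idx -> R) -> R) (x y z : R) :
  measurable_fun setT (f : cylT setT -> R) -> (forall w, 0 <= f w) ->
  measurable_fun setT (g : cylT setT -> R) -> (forall w, 0 <= g w) ->
  ex f = x%:E -> ex g = y%:E -> ex (f \* g) = z%:E ->
  ex (average m f \* average m g) = (m^-1 * z + b / m ^+ 2 * (x * y))%:E.
Proof.
move=> mf f0 mg g0 fx gy fgz.
have x0 : 0 <= x by rewrite -lee_fin -fx; exact: ex_ge0.
have y0 : 0 <= y by rewrite -lee_fin -gy; exact: ex_ge0.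
have z0 : 0 <= z by rewrite -lee_fin -fgz; apply: ex_ge0 => w; exact: mulr_ge0.
pose G k w := (\sum_(i < k) f (subtree i w)) * (\sum_(i < k) g (subtree i w)).
have mG k J : (forall i u, J (branch i u)) ->
    measurable_fun setT (G k : cylT J -> R).
  by move=> Jb; apply: measurable_funM; exact: mS.
have G0 k w : 0 <= G k w by apply: mulr_ge0; exact: S0.
transitivity (ex (fun w => m ^- 2 * G (nu w) w)).
  apply: eq_integral => w _; congr EFin; rewrite /= /average /G.
  by field; rewrite gt_eqF.
under eq_integral => w _ do rewrite EFinM.
have mGnu : measurable_fun setT ((fun w => G (nu w) w) : cylT setT -> R).
  by apply: (@measurable_nu_dep _ setT) => // k; exact: mG.
rewrite ge0_integralZl//; last 3 first.
- exact: (@measurable_ex (fun w => G (nu w) w) setT mGnu).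
- by move=> w _; rewrite lee_fin.
- by rewrite lee_fin invr_ge0 exprn_ge0// ltW.
rewrite (ex_nu_dep (G := G))//; last first.
  by move=> k; apply: mG; exact: branch_neq_inl.
transitivity ((m ^- 2)%:E * (m * z + b * (x * y))%:E)%E; last first.
  by rewrite -EFinM; congr EFin; field; rewrite gt_eqF.
congr (_ * _)%E; rewrite -moment_series ?mulr_ge0//.
apply: eq_eseriesr => k _; congr (_ * _)%E.
transitivity (\sum_(i < k) \sum_(j < k)
    ex (fun w => f (subtree i w) * g (subtree j w)))%E.
  have mfg i j : measurable_fun setT (fun w => (f (subtree i (sample X w)) *
      g (subtree j (sample X w)))%:E).
    apply: (@measurable_ex (fun w => f (subtree i w) * g (subtree j w)) setT).
    by apply: measurable_funM; exact: measurable_subtree.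
  transitivity (\int[P]_w (\sum_(i < k) \sum_(j < k) (f (subtree i (sample X w)) *
      g (subtree j (sample X w)))%:E))%E.
    apply: eq_integral => w _; rewrite /G mulr_suml -sumEFin.
    by apply: eq_bigr => i _; rewrite mulr_sumr -sumEFin.
  rewrite ge0_integral_sum//; last 2 first.
  - by move=> i; apply: emeasurable_sum.
  - by move=> i w _; apply: sume_ge0 => j _; rewrite lee_fin mulr_ge0.
  apply: eq_bigr => i _; rewrite ge0_integral_sum// => j w _.
  by rewrite lee_fin mulr_ge0.
transitivity (\sum_(i < k) (z + k.-1%:R * (x * y))%:E)%E; last first.
  rewrite sumEFin big_const_ord iter_addr_0 -[in LHS]mulr_natl natrM; congr EFin.
  ring.
apply: eq_bigr => i _; rewrite (bigD1 i)//= EFinD; congr (_ + _)%E.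
  rewrite -fgz; apply: (@ex_subtree i (f \* g)) => [|w]; last exact: mulr_ge0.
  exact: measurable_funM.
transitivity (\sum_(j < k | j != i) (x * y)%:E)%E.
  apply: eq_bigr => j ji; rewrite ex_subtreeM ?fx ?gy//.
  by rewrite eq_sym.
rewrite sumEFin sumr_const; congr EFin.
by rewrite -[LHS]mulr_natl cardC1 card_ord.
Qed.

Lemma ex_average (f : (idx -> R) -> R) (x : R) :
  measurable_fun setT (f : cylT setT -> R) -> (forall w, 0 <= f w) ->
  ex f = x%:E -> ex (average m f) = x%:E.
Proof.
move=> mf f0 fx.
have x0 : 0 <= x by rewrite -lee_fin -fx; exact: ex_ge0.
pose G k w := \sum_(i < k) f (subtree i w).
have mG k J : (forall i u, J (branch i u)) ->
    measurable_fun setT (G k : cylT J -> R).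
  by move=> Jb; exact: mS.
have G0 k w : 0 <= G k w by exact: S0.
have mGnu : measurable_fun setT ((fun w => G (nu w) w) : cylT setT -> R).
  by apply: (@measurable_nu_dep _ setT) => // k; exact: mG.
transitivity (ex (fun w => m^-1 * G (nu w) w)) => //.
under eq_integral => w _ do rewrite EFinM.
rewrite ge0_integralZl//; last 3 first.
- exact: (@measurable_ex (fun w => G (nu w) w) setT mGnu).
- by move=> w _; rewrite lee_fin.
- by rewrite lee_fin invr_ge0 ltW.
rewrite (ex_nu_dep (G := G))//; last first.
  by move=> k; apply: mG; exact: branch_neq_inl.
transitivity ((m^-1)%:E * (m * x + b * 0)%:E)%E; last first.
  by rewrite -EFinM; congr EFin; field; rewrite gt_eqF.
congr (_ * _)%E; rewrite -moment_series//.
apply: eq_eseriesr => k _; congr (_ * _)%E.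
transitivity (\sum_(i < k) ex (fun w => f (subtree i w)))%E.
  under eq_integral => w _ do rewrite -sumEFin.
  rewrite ge0_integral_sum//; last by move=> i w _; rewrite lee_fin.
  move=> i; apply: (@measurable_ex (fun w => f (subtree i w)) setT).
  exact: measurable_subtree.
under eq_bigr do rewrite ex_subtree// fx.
by rewrite sumEFin big_const_ord iter_addr_0 -[in LHS]mulr_natl mulr0 addr0.
Qed.

End branching_moments.

(** * Dirichlet principle and the recursion at the root *)

Section dirichlet.
Context {R : realType}.
Implicit Types (N : seq nat -> nat) (c f : seq nat -> R) (w : idx -> R).

(** [level] grows at the leaves, whereas the conductance recursion cuts at the root; this converts
    one into the other. *)
Lemma level_branch N k : level N k.+1 =
  flatten [seq [seq rcons u i | u <- level (fun u => N (rcons u i)) k] |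
           i <- iota 0 (N [::])].
Proof.
elim: k => [|k IHk]; first by rewrite /= cats0; elim: iota => //= i s ->.
have levelS M l : level M l.+1 =
  flatten [seq [seq i :: u | i <- iota 0 (M u)] | u <- level M l] by [].
rewrite levelS {}IHk map_flatten -map_comp.
set s := iota 0 (N [::]); elim: s => //= i s.
rewrite flatten_cat => ->; congr (_ ++ _).
rewrite map_flatten -!map_comp; congr flatten; apply: eq_map => u /=.
by rewrite -map_comp.
Qed.

Lemma big_level_branch N k (F : seq nat -> R) :
  \sum_(u <- level N k.+1) F u =
  \sum_(i < N [::]) \sum_(u <- level (fun u => N (rcons u i)) k) F (rcons u i).
Proof.
rewrite level_branch big_flatten big_map.
rewrite -(big_mkord xpredT (fun i =>
  \sum_(u <- level (fun u => N (rcons u i)) k) F (rcons u i))) /index_iota subn0.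
by apply: eq_bigr => i _; rewrite big_map.
Qed.

Lemma level_size N k u : u \in level N k -> size u = k.
Proof.
elim: k u => [|k IHk] u; first by rewrite inE => /eqP ->.
by move=> /flattenP[_ /mapP[v /IHk <- ->]] /mapP[i _ ->].
Qed.

Lemma energy_branch N c n f : energy N c n.+1 f =
  \sum_(i < N [::]) (c [:: val i] * (f [::] - f [:: val i]) ^+ 2 +
    energy (fun u => N (rcons u i)) (fun u => c (rcons u i)) n
           (fun u => f (rcons u i))).
Proof.
rewrite /energy big_ord_recl big_level_branch big_split /=; congr (_ + _).
  by apply: eq_bigr => i _; rewrite big_seq1.
rewrite exchange_big /=; apply: eq_bigr => k _.
etransitivity.
  exact: (big_level_branch N k.+1 (fun u => c u * (f (behead u) - f u) ^+ 2)).
apply: eq_bigr => i _.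
(* [behead] commutes with [rcons] only on nonempty labels; labels in level [k.+1] have positive
   size. *)
rewrite big_seq [RHS]big_seq; apply: eq_bigr => u /level_size.
by case: u.
Qed.

(* [cond m n] is the conductance to depth [n.+1]. *)
Fixpoint cond (m : R) (n : nat) (w : idx -> R) : R :=
  if n is n'.+1 then
    average m (fun v => cond m n' v / (1 + edge v * cond m n' v)) w
  else average m (fun v => (edge v)^-1) w.

Lemma cond_ge0 (m : R) n w : 0 < m -> 0 <= cond m n w.
Proof.
move=> m0; elim: n w => [|n IHn] w; apply: average_ge0 => // v.
  by rewrite invr_ge0 edge_ge0.
by rewrite divr_ge0// addr_ge0// mulr_ge0// edge_ge0.
Qed.

Definition network_N w : seq nat -> nat := fun u => Num.truncn (w (inl u)).

(** Depths drop by one in a subtree, which multiplies its conductances by [1 / m]; the scale [s]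
    absorbs this factor in the inductions. *)
Definition network_c (m s : R) w : seq nat -> R :=
  fun u => s / (m ^+ size u * w (inr u)).

Lemma network_c_subtree (m s : R) w i : 0 < m -> (forall u, 0 < w (inr u)) ->
  (fun u => network_c m s w (rcons u i)) = network_c m (s / m) (subtree i w).
Proof.
move=> m0 w0; apply/funext => u.
rewrite /network_c /subtree /= size_rcons exprS; field.
by rewrite !gt_eqF// exprn_gt0.
Qed.

(* Minimizing over the middle potential [t] leaves the conductance of [x] and
   [y] in series. *)
Lemma series_min (x y a t : R) : 0 < x -> 0 <= y ->
  x * (a - t) ^+ 2 + y * t ^+ 2 =
  x * y / (x + y) * a ^+ 2 + (x * (a - t) - y * t) ^+ 2 / (x + y).
Proof. by move=> x0 y0; field; rewrite gt_eqF// ltr_wpDr. Qed.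

Lemma series_edge (m s e x : R) : 0 < m -> 0 < s -> 0 < e -> 0 <= x ->
  (s / (m * e)) * (s / m * x) / (s / (m * e) + s / m * x) =
  s / m * (x / (1 + e * x)).
Proof.
move=> m0 s0 e0 x0; field.
have ex0 : 0 <= e * x by rewrite mulr_ge0// ltW.
have sxe0 : 0 <= s * x * e by rewrite !mulr_ge0// ltW.
by rewrite (gt_eqF m0) (gt_eqF e0) !gt_eqF// ltr_pwDl.
Qed.

(** The root potential is left arbitrary because the induction applies to each branch with the
    potential of its own root; [series_min] then discards a square. *)
Lemma cond_le_energy (m s : R) n w f : 0 < m -> 0 < s -> (forall u, 0 < w (inr u)) ->
  (forall u, u \in level (network_N w) n.+1 -> f u = 0) ->
  s * cond m n w * (f [::]) ^+ 2 <= energy (network_N w) (network_c m s w) n.+1 f.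
Proof.
move=> m0; elim: n s w f => [|n IHn] s w f s0 w0 f0.
  rewrite energy_branch /= /average (mulrA s) mulr_sumr mulr_suml.
  apply: ler_sum => i _; rewrite /energy big_ord0 addr0.
  rewrite (f0 [:: val i]); last first.
    rewrite /= cats0; apply/mapP; exists (val i) => //.
    by rewrite mem_iota add0n ltn_ord.
  rewrite subr0 /network_c /edge /subtree /= expr1 gtr0_norm//.
  by rewrite le_eqVlt; apply/orP; left; apply/eqP; field; rewrite !gt_eqF.
rewrite energy_branch /= /average (mulrA s) mulr_sumr mulr_suml.
apply: ler_sum => i _.
have wi0 u : 0 < subtree i w (inr u) by exact: w0.
have sm0 : 0 < s / m by rewrite divr_gt0.
have fi0 u : u \in level (network_N (subtree i w)) n.+1 -> f (rcons u (val i)) = 0.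
  move=> uin; apply: f0; rewrite level_branch; apply/flattenP.
  exists [seq rcons u (val i) |
      u <- level (fun u => network_N w (rcons u (val i))) n.+1].
    by apply/mapP; exists (val i) => //; rewrite mem_iota add0n ltn_ord.
  by apply/mapP; exists u.
rewrite network_c_subtree//.
apply: le_trans (lerD (lexx _) (IHn _ _ (fun u => f (rcons u (val i))) sm0 wi0 fi0)).
set x := cond m n (subtree i w); have x0 : 0 <= x by exact: cond_ge0.
have e0 : 0 < edge (subtree i w) by rewrite normr_gt0 gt_eqF.
rewrite series_min; last 2 first.
- by rewrite divr_gt0// mulr_gt0 ?exprn_gt0.
- by rewrite mulr_ge0// ltW.
rewrite /network_c /= expr1 (_ : w (inr [:: val i]) = edge (subtree i w)); last first.
  by rewrite /edge /subtree /= gtr0_norm.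
rewrite series_edge// lerDl divr_ge0 ?sqr_ge0// addr_ge0//.
  by rewrite ltW// divr_gt0// mulr_gt0.
by rewrite mulr_ge0// ltW.
Qed.

Lemma energy_eq_cond (m s : R) n w (a : R) : 0 < m -> 0 < s -> (forall u, 0 < w (inr u)) ->
  exists f, [/\ f [::] = a,
    forall u, u \in level (network_N w) n.+1 -> f u = 0 &
    energy (network_N w) (network_c m s w) n.+1 f = s * cond m n w * a ^+ 2].
Proof.
move=> m0; elim: n s w a => [|n IHn] s w a s0 w0.
  exists (fun u => if u is [::] then a else 0); split => //.
    by move=> u /level_size; case: u.
  rewrite energy_branch /= /average (mulrA s) mulr_sumr mulr_suml.
  apply: eq_bigr => i _; rewrite /energy big_ord0 addr0.
  rewrite subr0 /network_c /edge /subtree /= expr1 gtr0_norm//.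
  by field; rewrite !gt_eqF.
have sm0 : 0 < s / m by rewrite divr_gt0.
pose x i := network_c m s w [:: i].
pose y i := s / m * cond m n (subtree i w).
(* The voltage divider: this potential at the child makes the square in [series_min] vanish. *)
pose t i := x i * a / (x i + y i).
have [phi phiP] := choice (fun i =>
  IHn (s / m) (subtree i w) (t i) sm0 (fun u => w0 (rcons u i))).
(* Glues the optimal potentials of the branches; reversing a label exposes its first-generation
   ancestor. *)
pose f u := if rev u is i :: v then phi i (rev v) else a.
have fr i : (fun u => f (rcons u i)) = phi i.
  by apply/funext => u; rewrite /f rev_rcons revK.
exists f; split => //.
  move=> u; rewrite level_branch => /flattenP[_ /mapP[i _ ->]] /mapP[v vl ->].
  by have [_ h _] := phiP i; rewrite -[RHS](h v vl) -fr.
rewrite energy_branch /= /average (mulrA s) mulr_sumr mulr_suml.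
apply: eq_bigr => i _; have [p1 _ p3] := phiP i.
rewrite fr network_c_subtree// p3.
have -> : f [:: val i] = t i by rewrite -p1 -fr.
have e0 : 0 < edge (subtree i w) by rewrite normr_gt0 gt_eqF// w0.
have x0 : 0 < x i by rewrite divr_gt0// mulr_gt0 ?exprn_gt0.
have c0 : 0 <= cond m n (subtree i w) by exact: cond_ge0.
have y0 : 0 <= y i by rewrite mulr_ge0// ltW.
have xy0 : x i + y i != 0 by rewrite gt_eqF// ltr_wpDr.
rewrite series_min// -/(x i) -/(y i).
rewrite (_ : x i * (a - t i) - y i * t i = 0); last by rewrite /t; field.
rewrite expr0n /= mul0r addr0; congr (_ * _).
rewrite /x /network_c /= expr1 (_ : w (inr [:: val i]) = edge (subtree i w)); last first.
  by rewrite /edge /subtree /= gtr0_norm// w0.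
by rewrite /y series_edge.
Qed.

Lemma eff_conductance_cond (m : R) n w : 0 < m -> (forall u, 0 < w (inr u)) ->
  eff_conductance (network_N w) (network_c m 1 w) n.+1 = cond m n w.
Proof.
move=> m0 w0; rewrite /eff_conductance; set A := (X in inf X).
have lbA : lbound A (cond m n w).
  move=> _ [f [f1 f0] <-].
  by have := cond_le_energy m0 ltr01 w0 f0; rewrite f1 expr1n mul1r mulr1.
have Ac : A (cond m n w).
  have [f [f1 f0 fE]] := energy_eq_cond n 1 m0 ltr01 w0.
  by exists f => //; rewrite fE expr1n mul1r mulr1.
apply/eqP; rewrite eq_le; apply/andP; split.
  by apply: ge_inf => //; exists (cond m n w).
by apply: lb_le_inf => //; exists (cond m n w).
Qed.

End dirichlet.

(** * Almost sure convergence from summable expectations *)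

Section almost_sure.
Context {d : measure_display} {T : measurableType d} {R : realType}.
Variable P : {measure set T -> \bar R}.

(** The sum of the [f k] has expectation at most [M], so it is almost surely finite and its terms
    tend to 0. *)
Lemma ae_cvg0 (f : nat -> T -> R) (b : nat -> R) (M : R) :
  (forall k, measurable_fun setT (f k)) -> (forall k w, 0 <= f k w) ->
  (forall k, (\int[P]_w (f k w)%:E <= (b k)%:E)%E) ->
  (forall n, \sum_(k < n) b k <= M) ->
  {ae P, forall w, (fun k => f k w) @ \oo --> (0 : R)}.
Proof.
move=> mf f0 fb bM.
have mf' k : measurable_fun setT (fun w => (f k w)%:E) by exact/measurable_EFinP.
pose F w := (\sum_(k <oo) (f k w)%:E)%E.
have F0 w : (0 <= F w)%E by apply: nneseries_ge0 => k _ _; rewrite lee_fin.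
have mF : measurable_fun setT F.
  by apply: ge0_emeasurable_sum => // k w _ _; rewrite lee_fin.
have iF : P.-integrable setT F.
  apply/integrableP; split => //.
  under eq_integral => w _ do rewrite gee0_abs//.
  rewrite integral_nneseries//; last by move=> k w _; rewrite lee_fin.
  apply: (@le_lt_trans _ _ M%:E); last exact: ltry.
  apply: lime_le.
    apply: is_cvg_ereal_nneg_natsum => k _.
    by apply: integral_ge0 => w _; rewrite lee_fin.
  apply: nearW => n; rewrite big_mkord.
  apply: (@le_trans _ _ (\sum_(k < n) (b k)%:E)%E).
    by apply: lee_sum => k _; exact: fb.
  by rewrite sumEFin lee_fin.
have := integrable_ae measurableT iF.
apply: filterS => w /(_ I) Ffin.
apply: cvg_series_cvg_0.
apply: nondecreasing_is_cvgn.
  by apply/nondecreasing_seqP => n; rewrite seriesSr lerDl.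
exists (fine (F w)) => _ [n _ <-].
rewrite -lee_fin fineK// /series /= -sumEFin.
by apply: nneseries_lim_ge => k _ _; rewrite lee_fin.
Qed.

End almost_sure.

(** * Two facts on real sequences *)

Section sequences.
Context {R : realType}.

Lemma squares_cvg0 (u : nat -> R) :
  (fun k => u k ^+ 2) @ \oo --> (0 : R) -> u @ \oo --> (0 : R).
Proof.
move=> /cvgrPdist_lt u0; apply/cvgrPdist_lt => eps eps0.
have := u0 (eps ^+ 2) (exprn_gt0 _ eps0); apply: filterS => k.
rewrite !sub0r !normrN normrX ltr_sqr ?nnegrE//.
exact: ltW.
Qed.

(* A ratio of two nonincreasing sequences is sandwiched between consecutive
   terms of a sparse subsequence. *)
Lemma ratio_subseq_cvg (C c : nat -> R) (N : nat -> nat) (W : R) :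
  (forall n, 0 <= C n) -> (forall n, C n.+1 <= C n) ->
  (forall n, 0 < c n) -> (forall n, c n.+1 <= c n) ->
  (forall k, (N k < N k.+1)%N) ->
  (fun k => C (N k) / c (N k)) @ \oo --> W ->
  (fun k => c (N k.+1) / c (N k)) @ \oo --> (1 : R) ->
  (fun n => C n / c n) @ \oo --> W.
Proof.
move=> C0 Cd c0 cd Nk CW c1.
have Cle i j : (i <= j)%N -> C j <= C i by move=> ij; exact: (nonincreasing_seqP C).1.
have cle i j : (i <= j)%N -> c j <= c i by move=> ij; exact: (nonincreasing_seqP c).1.
pose rho k := c (N k.+1) / c (N k).
pose x k := C (N k) / c (N k).
have low : (fun k => x k.+1 * rho k) @ \oo --> W.
  rewrite -[W]mulr1; apply: cvgM => //.
  by move: CW; rewrite -(cvg_shiftS x).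
have upp : (fun k => x k * (rho k)^-1) @ \oo --> W.
  rewrite -[W]mulr1 -[1]invr1; apply: cvgM => //.
  by apply: cvgV => //; exact: oner_neq0.
apply/cvgrPdist_lt => eps eps0.
move/cvgrPdist_lt: low => /(_ _ eps0) [k1 _ lowk].
move/cvgrPdist_lt: upp => /(_ _ eps0) [k2 _ uppk].
pose k0 := maxn k1 k2.
have split n : (N k0 <= n)%N -> exists k, [/\ (k0 <= k)%N, (N k <= n)%N & (n <= N k.+1)%N].
  elim: n => [|n IHn] kn.
    by exists k0; split => //; exact: leq_trans kn (leq0n _).
  move: kn; rewrite leq_eqVlt => /orP[/eqP kn|].
    by exists k0; rewrite leqnn kn leqnn -kn ltnW.
  rewrite ltnS => /IHn[k [k0k Nkn nN]].
  have [nN'|Nn'] := ltnP n (N k.+1).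
    by exists k; split => //; exact: leqW.
  exists k.+1; split; [exact: leqW|exact: leqW|].
  by rewrite (leq_ltn_trans nN)//.
exists (N k0) => // n /= /split[k [k0k Nkn nN]].
have k1k : (k1 <= k)%N by exact: leq_trans (leq_maxl _ _) k0k.
have k2k : (k2 <= k)%N by exact: leq_trans (leq_maxr _ _) k0k.
have h1 : x k.+1 * rho k <= C n / c n.
  rewrite /x /rho mulrA divfK ?gt_eqF//.
  by apply: ler_pM; rewrite ?invr_ge0 ?C0 ?(ltW (c0 _)) ?Cle ?lef_pV2 ?posrE ?cle.
have h2 : C n / c n <= x k * (rho k)^-1.
  rewrite /x /rho invf_div mulrA divfK ?gt_eqF//.
  by apply: ler_pM; rewrite ?invr_ge0 ?C0 ?(ltW (c0 _)) ?Cle ?lef_pV2 ?posrE ?cle.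
have := lowk k k1k; have := uppk k k2k.
rewrite /= !ltr_norml => /andP[a1 a2] /andP[b1 b2].
by apply/andP; split; lra.
Qed.

End sequences.

(** * Calculus of expectations for nonnegative functionals *)

Section conductance_moments.
Context {d : measure_display} {T : measurableType d} {R : realType}.
Context (P : probability T R) (X : idx -> T -> R) (p : nat -> R) (m b : R).
Context (a e : R).
Hypothesis mX : forall i, measurable_fun setT (X i).
Hypothesis iX : mutually_independent P X.
Hypothesis X_inl : forall u v B, measurable B ->
  P (X (inl u) @^-1` B) = P (X (inl v) @^-1` B).
Hypothesis X_inr : forall u v B, measurable B ->
  P (X (inr u) @^-1` B) = P (X (inr v) @^-1` B).
Hypothesis X_inr_gt0 : forall u w, 0 < X (inr u) w.
Hypothesis p_nu : forall k, P [set w | nu (sample X w) = k] = (p k)%:E.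
Hypothesis m1 : 1 < m.
Hypothesis mean1 : (\sum_(k <oo) (k%:R * p k)%:E = m%:E)%E.
Hypothesis mean2 : (\sum_(k <oo) ((k * k.-1)%:R * p k)%:E = b%:E)%E.

Notation ex f := (\int[P]_w (f (sample X w))%:E)%E.

Hypothesis ex_edge : ex edge = e%:E.
Hypothesis ex_inv_edge : ex (fun w => (edge w)^-1) = a%:E.

Let m0 : 0 < m. Proof. exact: lt_trans ltr01 m1. Qed.

Definition admissible (f : (idx -> R) -> R) :=
  measurable_fun setT (f : cylT setT -> R) /\ forall w, 0 <= f w.

Lemma admissible_cst (r : R) : 0 <= r -> admissible (fun=> r).
Proof. by move=> r0; split => //; exact: measurable_cst. Qed.

Lemma admissibleM f g : admissible f -> admissible g -> admissible (f \* g).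
Proof.
move=> [mf f0] [mg g0]; split => [|w]; last exact: mulr_ge0.
exact: measurable_funM.
Qed.

Lemma admissibleD f g : admissible f -> admissible g ->
  admissible (fun w => f w + g w).
Proof.
move=> [mf f0] [mg g0]; split => [|w]; last exact: addr_ge0.
exact: measurable_funD.
Qed.

Lemma admissibleZ (r : R) f : 0 <= r -> admissible f ->
  admissible (fun w => r * f w).
Proof. by move=> r0; apply: admissibleM; exact: admissible_cst. Qed.

Lemma admissibleV f : admissible f -> admissible (fun w => (f w)^-1).
Proof.
move=> [mf f0]; split => [|w]; last by rewrite invr_ge0.
exact: (@measurable_inv _ _ (cylT setT) f).
Qed.

Lemma admissible_edge : admissible (@edge R).
Proof. by split => [|w]; [exact: measurable_edge|exact: edge_ge0]. Qed.

Lemma admissible_average f : admissible f -> admissible (average m f).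
Proof.
move=> [mf f0]; split => [|w]; first exact: measurable_averageT.
exact: average_ge0.
Qed.

Lemma admissible_iter k f : admissible f -> admissible (iter k (average m) f).
Proof. by move=> f0; elim: k => //= k; exact: admissible_average. Qed.

Lemma measurable_EFin_sample f : admissible f ->
  measurable_fun setT (fun w => (f (sample X w))%:E).
Proof. by move=> [mf _]; exact: (measurable_ex mX mf). Qed.

Lemma ex_le f g : admissible f -> admissible g ->
  (forall w, f (sample X w) <= g (sample X w)) -> (ex f <= ex g)%E.
Proof.
move=> af ag fg; apply: ge0_le_integral => //.
- by move=> w _; rewrite lee_fin af.2.
- exact: measurable_EFin_sample.
- exact: measurable_EFin_sample.
- by move=> w _; rewrite lee_fin.
Qed.

Lemma ex_lin f g (r s : R) : admissible f -> admissible g -> 0 <= r -> 0 <= s ->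
  (ex (fun w => r * f w + s * g w)%R = r%:E * ex f + s%:E * ex g)%E.
Proof.
move=> af ag r0 s0.
under eq_integral => w _ do rewrite EFinD !EFinM.
have mf := measurable_EFin_sample af; have mg := measurable_EFin_sample ag.
rewrite ge0_integralD//; last 4 first.
- by move=> w _; rewrite -EFinM lee_fin mulr_ge0// af.2.
- exact: measurable_funeM.
- by move=> w _; rewrite -EFinM lee_fin mulr_ge0// ag.2.
- exact: measurable_funeM.
by congr (_ + _)%E; rewrite ge0_integralZl// => w _; rewrite lee_fin ?af.2 ?ag.2.
Qed.

Lemma ex_cst (r : R) : ex (fun=> r) = r%:E.
Proof. by rewrite integral_cst//= probability_setT mule1. Qed.

Lemma ex_fin f (r : R) : admissible f -> (ex f <= r%:E)%E ->
  exists2 x : R, 0 <= x <= r & ex f = x%:E.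
Proof.
move=> af fr; have f0 := ex_ge0 P X af.2.
have ffin : ex f \is a fin_num by rewrite ge0_fin_numE// (le_lt_trans fr)// ltry.
by exists (fine (ex f)); rewrite ?fineK// -!lee_fin fineK// f0.
Qed.

Lemma ex_av f (x : R) : admissible f -> ex f = x%:E -> ex (average m f) = x%:E.
Proof.
by move=> [mf f0] fx; apply: (ex_average mX iX X_inl X_inr p_nu m0 mean1 mean2).
Qed.

Lemma ex_avM f g (x y z : R) : admissible f -> admissible g ->
  ex f = x%:E -> ex g = y%:E -> ex (f \* g) = z%:E ->
  ex (average m f \* average m g) = (m^-1 * z + b / m ^+ 2 * (x * y))%:E.
Proof.
by move=> [? ?] [? ?] *; apply: (ex_averageM mX iX X_inl X_inr p_nu m0 mean1 mean2).
Qed.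

(** The factor at [inr [::]] is independent of any functional that does not read this coordinate.
    The function [h] covers both [edge] and its inverse. *)
Lemma ex_edgeM (h : R -> R) f (x y : R) :
  measurable_fun setT (f : cylT [set~ inr [::]] -> R) -> (forall w, 0 <= f w) ->
  measurable_fun setT ((fun w => h (edge w)) : cylT [set inr [::]] -> R) ->
  (forall w, 0 <= h (edge w)) ->
  ex (fun w => h (edge w)) = x%:E -> ex f = y%:E ->
  ex (fun w => h (edge w) * f w) = (x * y)%:E.
Proof.
move=> mf f0 mh h0 hx fy.
have := @ex_indepM _ _ _ _ P X mX iX _ _ (fun w => h (edge w)) f
  (setICr [set inr [::]]) mh mf h0 f0.
by rewrite hx fy -EFinM.
Qed.

(** * Mean conductance: monotonicity and upper bound *)

Let C := cond m.

Lemma measurable_cond n : measurable_fun setT (C n : cylT [set~ inr [::]] -> R).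
Proof.
have root : [set~ inr [::]] (inl [::] : idx) by [].
elim: n => [|n IHn].
  apply: (@measurable_average _ _ root _ setT) => //.
    by move=> i u _; exact: branch_neq_inr.
  exact: (admissibleV admissible_edge).1.
apply: (@measurable_average _ _ root _ setT) => //.
  by move=> i u _; exact: branch_neq_inr.
have aC : admissible (C n).
  split => [|w]; last exact: cond_ge0.
  by apply: (sub_measurable_cylT _ IHn).
apply: (admissibleM aC (admissibleV _)).1.
apply: admissibleD; first exact: admissible_cst.
exact: (admissibleM admissible_edge aC).
Qed.

Lemma admissible_cond n : admissible (C n).
Proof.
split => [|w]; last exact: cond_ge0.
by apply: (sub_measurable_cylT _ (measurable_cond n)).
Qed.

Let g n w := C n w / (1 + edge w * C n w).

Lemma admissible_g n : admissible (g n).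
Proof.
have aC := admissible_cond n.
apply: (admissibleM aC (admissibleV _)).
apply: admissibleD; first exact: admissible_cst.
exact: (admissibleM admissible_edge aC).
Qed.

Lemma g_le n w : g n w <= C n w.
Proof.
have C0 : 0 <= C n w by exact: cond_ge0.
by rewrite /g ler_piMr// invf_le1 ?lerDl ?ltr_pwDl// mulr_ge0// edge_ge0.
Qed.

Lemma edge_sample_gt0 w : 0 < edge (sample X w).
Proof. by rewrite normr_gt0 gt_eqF// X_inr_gt0. Qed.

Let c n := fine (ex (C n)).

(** [c] is defined through [fine], so finiteness has to travel along the induction; the bound [g_le]
    supplies it. *)
Lemma ex_condS n : ex (C n) = (c n)%:E -> ex (g n) = (c n.+1)%:E /\
  ex (C n.+1) = (c n.+1)%:E /\ c n.+1 <= c n.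
Proof.
move=> Cn.
have [x /andP[x0 xc] gx] : exists2 x : R, 0 <= x <= c n & ex (g n) = x%:E.
  apply: ex_fin; first exact: admissible_g.
  rewrite -Cn; apply: ex_le => [||w]; [exact: admissible_g| |exact: g_le].
  exact: admissible_cond.
have CS : ex (C n.+1) = x%:E by apply: ex_av => //; exact: admissible_g.
by rewrite /c CS.
Qed.

Lemma ex_cond n : ex (C n) = (c n)%:E.
Proof.
elim: n => [|n /ex_condS[_ []]//].
have C0 : ex (C 0) = a%:E.
  by apply: ex_av => //; exact: (admissibleV admissible_edge).
by rewrite /c C0.
Qed.

Lemma ex_g n : ex (g n) = (c n.+1)%:E.
Proof. by have [] := ex_condS (ex_cond n). Qed.

Lemma c_noninc n : c n.+1 <= c n.
Proof. by have [_ []] := ex_condS (ex_cond n). Qed.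

Lemma c0E : c 0 = a.
Proof.
rewrite /c (_ : ex (C 0) = a%:E)//.
by apply: ex_av => //; exact: (admissibleV admissible_edge).
Qed.

Lemma a_ge0 : 0 <= a.
Proof.
rewrite -lee_fin -ex_inv_edge; apply: (@ex_ge0 _ _ _ P X (fun v => (edge v)^-1)) => w.
by rewrite invr_ge0 edge_ge0.
Qed.

(* The left-hand side is the infimum over [t] of the right-hand side, whose
   expectation is linear in those of [x] and [z^-1]. *)
Lemma series_le (x z t : R) : 0 <= x -> 0 < z ->
  x / (1 + z * x) <= (1 - t) ^+ 2 * x + t ^+ 2 * z^-1.
Proof.
move=> x0 z0; have h : 0 < 1 + z * x by rewrite ltr_pwDl// mulr_ge0// ltW.
rewrite -subr_ge0.
rewrite (_ : _ - _ = (z * x * (1 - t) - t) ^+ 2 / (z * (1 + z * x))).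
  by rewrite divr_ge0 ?sqr_ge0// mulr_ge0// ltW.
by field; rewrite !gt_eqF.
Qed.

Lemma c_le n : c n <= a / n.+1%:R.
Proof.
elim: n => [|n IHn]; first by rewrite c0E divr1.
(* The minimizer of [(1 - t)^2 a / (n + 1) + t^2 a], whose minimum is exactly [a / (n + 2)]. *)
pose t : R := n.+2%:R^-1.
have aC := admissible_cond n; have aV := admissibleV admissible_edge.
have : (ex (g n) <= ((1 - t) ^+ 2 * c n + t ^+ 2 * a)%:E)%E.
  have := ex_lin aC aV (sqr_ge0 (1 - t)) (sqr_ge0 t).
  rewrite ex_cond ex_inv_edge -!EFinM -EFinD => <-.
  apply: (@ex_le (g n)
    (fun w => (1 - t) ^+ 2 * C n w + t ^+ 2 * (edge w)^-1)) => [||w].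
  - exact: admissible_g.
  - by apply: admissibleD; apply: admissibleZ => //; exact: sqr_ge0.
  - by apply: series_le; [exact: cond_ge0|exact: edge_sample_gt0].
rewrite ex_g lee_fin => /le_trans -> //.
apply: (@le_trans _ _ ((1 - t) ^+ 2 * (a / n.+1%:R) + t ^+ 2 * a)).
  by rewrite lerD2r ler_wpM2l ?sqr_ge0.
rewrite le_eqVlt; apply/orP; left; apply/eqP.
rewrite /t -[n.+2]addn1 natrD; have : 0 < n.+1%:R :> R by rewrite ltr0n.
set x := n.+1%:R => x0; field.
by rewrite !gt_eqF// addr_gt0.
Qed.

(** * Uniform flow and lower bound on the mean *)

(** The normalized population [#T_k / m^k], as [size_level] shows. *)
Let S k := iter k (average m) (fun=> 1 : R).

(** Energy of the flow carrying [m^-k] to each vertex of depth [k]. The edge above a child carries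
    [S k' / m] through resistance [m * edge], so it dissipates [edge * S k' ^ 2 / m]; the energy
    inside the child's subtree is scaled by [m * m^-2 = 1 / m] as well. *)
Fixpoint flow_energy (k : nat) : (idx -> R) -> R :=
  if k is k'.+1 then
    average m (fun w => edge w * (S k' w * S k' w) + flow_energy k' w)
  else fun=> 0.

Lemma admissible_S k : admissible (S k).
Proof. by apply: admissible_iter; exact: admissible_cst. Qed.

Lemma admissible_flow_energy k : admissible (flow_energy k).
Proof.
elim: k => [|k IHk]; first exact: admissible_cst.
apply: admissible_average; apply: admissibleD => //.
apply: (admissibleM admissible_edge).
by apply: admissibleM; exact: admissible_S.
Qed.

Lemma measurable_S k : measurable_fun setT (S k : cylT [set~ inr [::]] -> R).
Proof.
case: k => [|k]; first exact: measurable_cst.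
apply: (@measurable_average _ _ _ _ setT) => //.
  by move=> i u _; exact: branch_neq_inr.
exact: (admissible_S k).1.
Qed.

Lemma ex_S k : ex (S k) = 1%:E.
Proof.
elim: k => [|k IHk]; first exact: ex_cst.
by apply: ex_av => //; exact: admissible_S.
Qed.

Let B := b / m ^+ 2.

Lemma B_ge0 : 0 <= B.
Proof.
apply: divr_ge0; last by rewrite exprn_ge0// ltW.
rewrite -lee_fin -mean2.
apply: nneseries_ge0 => k _ _; rewrite lee_fin mulr_ge0//.
by rewrite -lee_fin -p_nu measure_ge0.
Qed.

(** The second moment of [S] obeys [s -> s / m + B], with fixed point [B / (1 - 1 / m)]; the added 1
    covers the initial value. *)
Let sigma := 1 + B / (1 - m^-1).

Let im1 : 0 < 1 - m^-1.
Proof. by rewrite subr_gt0 invf_lt1. Qed.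

Lemma ex_S2 k : exists2 s : R, 0 <= s <= sigma & ex (S k \* S k) = s%:E.
Proof.
have B0 := B_ge0; have Bm : 0 <= B / (1 - m^-1) by rewrite divr_ge0// ltW.
elim: k => [|k [s /andP[s0 sle] Sk]].
  exists 1; first by rewrite ler01 /sigma lerDl.
  by rewrite -ex_cst; apply: eq_integral => w _; rewrite /= mul1r.
exists (m^-1 * s + B).
  apply/andP; split.
    by apply: addr_ge0 => //; apply: mulr_ge0 => //; rewrite invr_ge0 ltW.
  apply: (@le_trans _ _ (m^-1 * sigma + B)).
    by rewrite lerD2r ler_wpM2l// invr_ge0 ltW.
  rewrite -lerBrDl -[X in _ <= X - _]mul1r -mulrBl /sigma mulrDr mulr1.
  by rewrite mulrCA divff ?gt_eqF// mulr1 lerDr ltW.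
have aS := admissible_S k.
have := ex_avM aS aS (ex_S k) (ex_S k) Sk.
by rewrite !mulr1; apply.
Qed.

Lemma e_ge0 : 0 <= e.
Proof.
by rewrite -lee_fin -ex_edge; apply: (@ex_ge0 _ _ _ P X edge) => w; exact: edge_ge0.
Qed.

Lemma sigma_ge0 : 0 <= sigma.
Proof. by have [s /andP[s0 /(le_trans s0)]] := ex_S2 0. Qed.

Lemma ex_id_edgeM f (y : R) :
  measurable_fun setT (f : cylT [set~ inr [::]] -> R) -> (forall w, 0 <= f w) ->
  ex f = y%:E -> ex (fun w => edge w * f w) = (e * y)%:E.
Proof.
move=> mf f0 fy; apply: (@ex_edgeM id) => // [|w]; last exact: edge_ge0.
exact: measurable_edge.
Qed.

(** Each generation adds [e] times a second moment of [S], the edge factor being independent of the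
    subtree below; hence linear growth. *)
Lemma ex_flow_energy k :
  exists2 x : R, 0 <= x <= k%:R * (e * sigma) & ex (flow_energy k) = x%:E.
Proof.
elim: k => [|k [x /andP[x0 xle] Dk]].
  by exists 0; [rewrite mul0r lexx|exact: ex_cst].
have [s /andP[s0 sle] Sk] := ex_S2 k.
have e0 := e_ge0.
exists (e * s + x).
  apply/andP; split; first by apply: addr_ge0 => //; exact: mulr_ge0.
  by rewrite -natr1 mulrDl mul1r addrC lerD// ler_wpM2l.
have aS := admissible_S k.
have aSS := admissibleM aS aS.
have aD := admissible_flow_energy k.
have aE := admissibleM admissible_edge aSS.
apply: ex_av; first exact: admissibleD.
have := ex_lin aE aD ler01 ler01; rewrite Dk.
rewrite (_ : ex (edge \* (S k \* S k)) = (e * s)%:E); last first.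
  apply: ex_id_edgeM => //; last exact: aSS.2.
  by apply: measurable_funM; exact: measurable_S.
rewrite !mul1e -EFinD => <-.
by apply: eq_integral => w _; rewrite /= !mul1r.
Qed.

(* Thomson's principle for the uniform flow, with the quotient
   [S ^ 2 / flow_energy] replaced by its tangents in [beta]. *)
Lemma cond_lower n (w : idx -> R) beta : (forall u, 0 < w (inr u)) ->
  2 * beta * S n.+1 w - beta ^+ 2 * flow_energy n.+1 w <= C n w.
Proof.
have averageB (f1 f2 f3 : (idx -> R) -> R) r s v :
    (forall i, r * f1 (subtree i v) - s * f2 (subtree i v) <= f3 (subtree i v)) ->
    r * average m f1 v - s * average m f2 v <= average m f3 v.
  move=> h; rewrite /average mulrCA (mulrCA s) -mulrBr.
  apply: ler_wpM2l; first by rewrite invr_ge0 ltW.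
  rewrite !mulr_sumr -sumrB.
  by apply: ler_sum => i _; exact: h.
elim: n w beta => [|n IHn] w beta w0.
  apply: averageB => i /=; rewrite !mul1r mulr1 addr0.
  have e0 : 0 < edge (subtree i w) by rewrite normr_gt0 gt_eqF// w0.
  rewrite -subr_ge0 mulr1.
  rewrite (_ : _ - _ = (1 - beta * edge (subtree i w)) ^+ 2 / edge (subtree i w)).
    by rewrite divr_ge0 ?sqr_ge0// ltW.
  by field; rewrite gt_eqF.
apply: (averageB (S n.+1) (fun v => edge v * (S n.+1 v * S n.+1 v) +
  flow_energy n.+1 v) (g n)) => i; rewrite /g.
have e0 : 0 < edge (subtree i w) by rewrite normr_gt0 gt_eqF// w0.
have x0 : 0 <= C n (subtree i w) by exact: cond_ge0.
(* With unit potential at the parent and 0 at the far end, the child sits at [1 / (1 + z x)]; [beta]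
   is rescaled by the inverse of this potential. *)
have := IHn (subtree i w) (beta * (1 + edge (subtree i w) * C n (subtree i w)))
  (fun u => w0 (rcons u i)).
rewrite -/(C n); move: e0 x0.
set x := C n _; set z := edge _; set s := S _ _; set D := flow_energy _ _.
move=> z0 x0 h; have k0 : 0 < 1 + z * x by rewrite ltr_pwDl// mulr_ge0// ltW.
rewrite -subr_ge0.
rewrite (_ : _ - _ = (x - (2 * (beta * (1 + z * x)) * s -
    (beta * (1 + z * x)) ^+ 2 * D)) / (1 + z * x) ^+ 2 +
    (z * x / (1 + z * x) - beta * s * z) ^+ 2 / z).
  by rewrite addr_ge0 ?divr_ge0 ?subr_ge0 ?sqr_ge0// ltW.
by field; rewrite !gt_eqF.
Qed.

(** The added 1 gives positivity from nonnegativity of [e] and [sigma] alone. *)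
Let q := e * sigma + 1.

Let q0 : 0 < q.
Proof. by rewrite /q ltr_wpDl// mulr_ge0 ?e_ge0 ?sigma_ge0. Qed.

Lemma c_ge n : (n.+1%:R * q)^-1 <= c n.
Proof.
have [x /andP[x0 xle] Dn] := ex_flow_energy n.+1.
have nq0 : 0 < n.+1%:R * q by rewrite mulr_gt0.
(* The maximizer of [2 beta - beta^2 (n + 1) q], which bounds [c n] from below in mean; the maximum
   is [beta] itself. *)
set beta := (_ * _)^-1.
have beta0 : 0 < beta by rewrite invr_gt0.
have aS := admissible_S n.+1; have aD := admissible_flow_energy n.+1.
have aC := admissible_cond n.
have : ((2 * beta)%:E <= (c n + beta ^+ 2 * x)%:E)%E.
  have -> : (2 * beta)%:E = ex (fun w => 2 * beta * S n.+1 w + 0 * S n.+1 w).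
    by rewrite ex_lin// ?ex_S ?mul0e ?adde0 ?mule1// mulr_ge0// ltW.
  have -> : (c n + beta ^+ 2 * x)%:E =
      ex (fun w => 1 * C n w + beta ^+ 2 * flow_energy n.+1 w).
    by rewrite ex_lin// ?sqr_ge0// Dn ex_cond mul1e.
  apply: (@ex_le (fun w => 2 * beta * S n.+1 w + 0 * S n.+1 w)
    (fun w => 1 * C n w + beta ^+ 2 * flow_energy n.+1 w)) => [||w].
  - apply: admissibleD; apply: admissibleZ => //.
    by rewrite mulr_ge0// ltW.
  - by apply: admissibleD; apply: admissibleZ => //; exact: sqr_ge0.
  - rewrite mul0r addr0 mul1r -lerBlDr; apply: cond_lower => u.
    exact: X_inr_gt0.
rewrite lee_fin => h.
have : beta ^+ 2 * x <= beta ^+ 2 * (n.+1%:R * q).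
  rewrite ler_wpM2l ?sqr_ge0// (le_trans xle)//.
  by rewrite ler_wpM2l// /q lerDl.
have -> : beta ^+ 2 * (n.+1%:R * q) = beta.
  by rewrite expr2 -mulrA /beta mulVf ?gt_eqF// mulr1.
move=> h'.
by move: (le_trans h (lerD (lexx _) h')); lra.
Qed.

(** * Second moment and decrements of the mean *)

Let y n := fine (ex (C n.+1 \* C n.+1)).

(* AM-GM: [(1 + z x)^2 >= 4 z x]; this makes the second moment finite from the
   second step on although [edge^-1] need not have one. *)
Lemma ex_g02_le : (ex (g 0 \* g 0) <= (4^-1 * (a * a))%:E)%E.
Proof.
have aV := admissibleV admissible_edge.
have aC := admissible_cond 0; have ag := admissible_g 0.
have h : ex (fun w => (edge w)^-1 * C 0 w) = (a * a)%:E.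
  apply: (@ex_edgeM (fun x => x^-1)) => //.
  - exact: measurable_cond.
  - exact: aC.2.
  - apply: (@measurable_inv _ _ (cylT [set inr [::]]) (@edge R)).
      exact: measurable_edge.
    exact: edge_ge0.
  - exact: aV.2.
  - by rewrite ex_cond c0E.
have := ex_lin (admissibleM aV aC) (admissible_cst (lexx 0)) (r := 4^-1)
  (s := 0) _ (lexx 0).
rewrite h mul0e adde0 -EFinM => <-; last by rewrite invr_ge0.
apply: (@ex_le (g 0 \* g 0) (fun w => 4^-1 * ((edge w)^-1 * C 0 w) + 0 * 0)).
- exact: admissibleM.
- apply: admissibleD; last by apply: admissible_cst; rewrite mulr0.
  by apply: admissibleZ; [rewrite invr_ge0|exact: admissibleM].
move=> w; have := edge_sample_gt0 w; have : 0 <= C 0 (sample X w) by exact: aC.2.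
rewrite /g /=; move: (C 0 _) (edge _) => x z x0 z0.
have k0 : 0 < 1 + z * x by rewrite ltr_pwDl// mulr_ge0// ltW.
rewrite mulr0 addr0 -subr_ge0.
rewrite (_ : _ - _ = x * (1 - z * x) ^+ 2 / (4 * z * (1 + z * x) ^+ 2)).
  apply: divr_ge0; first by rewrite mulr_ge0 ?sqr_ge0.
  by apply: mulr_ge0; [rewrite mulr_ge0// ltW|exact: sqr_ge0].
by field; rewrite !gt_eqF.
Qed.

Lemma ex_cond2S n (z : R) : ex (g n \* g n) = z%:E ->
  ex (C n.+1 \* C n.+1) = (m^-1 * z + B * (c n.+1 * c n.+1))%:E.
Proof.
have ag := admissible_g n.
by move=> gz; have := ex_avM ag ag (ex_g n) (ex_g n) gz; apply.
Qed.

(** As for [c], finiteness and the recursion are proved together; [ex_g02_le] starts the induction,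
    which is why [y] is shifted by one. *)
Lemma ex_cond2 n : ex (C n.+1 \* C n.+1) = (y n)%:E /\ y n.+1 <= m^-1 * y n + B * (c n.+2 * c n.+2).
Proof.
have step k : ex (C k.+1 \* C k.+1) = (y k)%:E ->
    ex (C k.+2 \* C k.+2) = (y k.+1)%:E /\ y k.+1 <= m^-1 * y k + B * (c k.+2 * c k.+2).
  move=> yk; have ag := admissible_g k.+1; have aC := admissible_cond k.+1.
  have [z /andP[z0 zy] gz] : exists2 z : R, 0 <= z <= y k &
      ex (g k.+1 \* g k.+1) = z%:E.
    apply: ex_fin; first exact: admissibleM.
    rewrite -yk; apply: (@ex_le (g k.+1 \* g k.+1) (C k.+1 \* C k.+1)).
    - exact: admissibleM.
    - exact: admissibleM.
    - by move=> w; apply: ler_pM; rewrite ?g_le// ag.2.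
  rewrite /y (ex_cond2S gz); split => //.
  by rewrite lerD2r ler_wpM2l// invr_ge0 ltW.
suff yn : ex (C n.+1 \* C n.+1) = (y n)%:E by have [] := step n yn.
elim: n => [|n /step[]//].
have ag := admissible_g 0.
have [z _ gz] := ex_fin (admissibleM ag ag) ex_g02_le.
by rewrite /y (ex_cond2S gz).
Qed.

Lemma y_ge0 n : 0 <= y n.
Proof.
rewrite -lee_fin -(ex_cond2 n).1.
by apply: (@ex_ge0 _ _ _ P X (C n.+1 \* C n.+1)) => w; rewrite mulr_ge0// cond_ge0.
Qed.

(** Pointwise [x - x / (1 + z x) <= z x^2], and the edge factor [z] is independent of the
    conductance [x] below it. *)
Lemma c_drop n : c n.+1 - c n.+2 <= e * y n.
Proof.
have aC := admissible_cond n.+1; have ag := admissible_g n.+1.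
have aCC := admissibleM aC aC; have aE := admissibleM admissible_edge aCC.
rewrite lerBlDl -lee_fin EFinD -ex_cond -(ex_g n.+1).
have := ex_lin ag aE ler01 ler01; rewrite !mul1e.
rewrite (_ : ex (edge \* (C n.+1 \* C n.+1)) = (e * y n)%:E); last first.
  apply: ex_id_edgeM; [|exact: aCC.2|exact: (ex_cond2 n).1].
  by apply: measurable_funM; exact: measurable_cond.
move=> <-; apply: (@ex_le (C n.+1)
  (fun w => 1 * g n.+1 w + 1 * (edge w * (C n.+1 w * C n.+1 w)))) => //.
  by apply: admissibleD; exact: admissibleZ.
move=> w; have := edge_sample_gt0 w.
have : 0 <= C n.+1 (sample X w) by exact: aC.2.
rewrite /g; move: (C n.+1 _) (edge _) => x z x0 z0.
have k0 : 0 < 1 + z * x by rewrite ltr_pwDl// mulr_ge0// ltW.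
rewrite -subr_ge0 !mul1r.
rewrite (_ : _ - _ = z ^+ 2 * x ^+ 3 / (1 + z * x)).
  apply: divr_ge0; last exact: ltW.
  by apply: mulr_ge0; apply: exprn_ge0 => //; exact: ltW.
by field; rewrite gt_eqF.
Qed.

Lemma c_gt0 n : 0 < c n.
Proof. by apply: lt_le_trans (c_ge n); rewrite invr_gt0 mulr_gt0. Qed.

(** In [y (n+1) <= y n / m + B c^2] the source term is [O(n^-2)] by [c_le]. The geometric
    contraction beats the growth of the weight [(n + K)^2], so the weighted sequence stays
    bounded. *)
Lemma y_le : exists2 M : R, 0 <= M & forall n, y n <= M / n.+1%:R ^+ 2.
Proof.
have a0 := a_ge0; have B0 := B_ge0.
(* For [x >= K] one has [(m - 1) x >= 6], hence [(x + 1)^2 <= r x^2] with [r = (m + 1) / 2 < m]: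
   passing to the next weight costs less than the contraction gains. *)
pose K : R := 1 + 6 / (m - 1).
have mm1 : 0 < m - 1 by rewrite subr_gt0.
have K1 : 1 <= K by rewrite /K lerDl divr_ge0// ltW.
have K0 : 0 < K := lt_le_trans ltr01 K1.
pose r := (m + 1) / 2.
pose beta := B * (a ^+ 2 * (1 + K) ^+ 2).
have beta0 : 0 <= beta.
  by apply: mulr_ge0 => //; apply: mulr_ge0; exact: sqr_ge0.
have r0 : 0 < r / m by rewrite divr_gt0// divr_gt0// addr_gt0.
have r1 : 0 < 1 - r / m.
  by rewrite subr_gt0 ltr_pdivrMr// mul1r /r ltr_pdivrMr//; lra.
(* The first term covers [n = 0]; the second is the fixed point of [M -> (r / m) M + beta], where
   [beta] bounds the weighted source term. *)
pose M := K ^+ 2 * y 0 + beta / (1 - r / m).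
have M0 : 0 <= M.
  apply: addr_ge0; last by rewrite divr_ge0// ltW.
  by rewrite mulr_ge0 ?y_ge0// sqr_ge0.
have key n : (n%:R + K) ^+ 2 * y n <= M.
  elim: n => [|n IHn].
    by rewrite add0r /M lerDl divr_ge0// ltW.
  have n0 : 0 <= n%:R :> R by [].
  have u0 : 0 < n%:R + K by rewrite ltr_wpDl.
  have ratio : (n.+1%:R + K) ^+ 2 <= r * (n%:R + K) ^+ 2.
    have K6 : 6 <= (m - 1) * (n%:R + K).
      apply: (@le_trans _ _ ((m - 1) * K)); last by rewrite ler_wpM2l ?lerDr// ltW.
      by rewrite /K mulrDr mulrCA divff ?gt_eqF// !mulr1 lerDr ltW.
    have h1 : 0 <= n%:R + K - 1 by lra.
    by rewrite -natr1 /r; nra.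
  have cb : (n.+1%:R + K) ^+ 2 * (c n.+2 * c n.+2) <= a ^+ 2 * (1 + K) ^+ 2.
    rewrite -expr2 -exprMn -exprMn ler_sqr ?nnegrE; last 2 first.
    - by apply: mulr_ge0; [rewrite addr_ge0// ltW|exact/ltW/c_gt0].
    - by rewrite mulr_ge0// addr_ge0// ltW.
    apply: (@le_trans _ _ ((n.+1%:R + K) * (a / n.+3%:R))).
      by rewrite ler_wpM2l ?c_le// addr_ge0// ltW.
    rewrite mulrCA ler_wpM2l// ler_pdivrMr// -[n.+3]addn2 -[n.+1]addn1 !natrD.
    by nra.
  have [_ yS] := ex_cond2 n.
  apply: (@le_trans _ _ ((n.+1%:R + K) ^+ 2 *
      (m^-1 * y n + B * (c n.+2 * c n.+2)))).
    by rewrite ler_wpM2l ?sqr_ge0.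
  rewrite mulrDr (mulrCA _ B).
  apply: (@le_trans _ _ (r / m * M + beta)).
    apply: lerD; last by rewrite ler_wpM2l.
    apply: (@le_trans _ _ (r * (n%:R + K) ^+ 2 * (m^-1 * y n))).
      by rewrite ler_wpM2r// mulr_ge0 ?y_ge0// invr_ge0 ltW.
    rewrite (_ : _ * _ = r / m * ((n%:R + K) ^+ 2 * y n)); last by ring.
    by rewrite ler_wpM2l// ltW.
  rewrite -lerBrDl -[X in _ <= X - _]mul1r -mulrBl /M mulrDr.
  rewrite (mulrC _ (beta / _)) divfK ?gt_eqF// lerDr.
  apply: mulr_ge0; first exact: ltW.
  by rewrite mulr_ge0 ?y_ge0// sqr_ge0.
exists M => // n; rewrite ler_pdivlMr ?exprn_gt0// mulrC.
apply: le_trans (key n); rewrite ler_wpM2r ?y_ge0// ler_sqr ?nnegrE//.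
  by rewrite -natr1 lerD2l.
by rewrite addr_ge0// ltW.
Qed.

(** Turns the bounds in powers of [1 / n] into bounds relative to [c], by inserting the lower bound
    [c_ge]; the factor 2 comes from [n + 2 <= 2 (n + 1)]. *)
Lemma drop_moment_bound : exists2 K : R, 0 <= K & forall n,
  c n.+1 - c n.+2 <= K / n.+1%:R * c n.+1 /\ y n <= K * c n.+1 ^+ 2.
Proof.
have [M M0 yM] := y_le; have e0 := e_ge0.
have cl n : 1 <= 2 * n.+1%:R * q * c n.+1.
  have := c_ge n.+1; rewrite -[_^-1]mul1r ler_pdivrMr ?mulr_gt0// => /le_trans -> //.
  rewrite mulrC ler_wpM2r ?(ltW (c_gt0 _))// ler_wpM2r ?(ltW q0)//.
  by rewrite -[n.+2%:R]natr1 -[n.+1%:R]natr1 mulrDr mulr1; have := ler0n R n; lra.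
have q20 : 0 < 2 * q by rewrite mulr_gt0.
have t1 : 0 <= e * M * (2 * q) by rewrite !mulr_ge0// (ltW q0).
have t2 : 0 <= M * (2 * q) ^+ 2 by rewrite mulr_ge0// sqr_ge0.
exists (e * M * (2 * q) + M * (2 * q) ^+ 2); first exact: addr_ge0.
move=> n; have n0 : 0 < n.+1%:R :> R by [].
have c0 := c_gt0 n.+1.
split.
  apply: (le_trans (c_drop n)); apply: (@le_trans _ _ (e * (M / n.+1%:R ^+ 2) * 1)).
    by rewrite mulr1 ler_wpM2l.
  apply: (@le_trans _ _ (e * (M / n.+1%:R ^+ 2) * (2 * n.+1%:R * q * c n.+1))).
    by rewrite ler_wpM2l// mulr_ge0// divr_ge0// sqr_ge0.
  rewrite (_ : _ * _ = e * M * (2 * q) / n.+1%:R * c n.+1); last first.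
    by field; rewrite gt_eqF.
  by rewrite ler_wpM2r ?(ltW c0)// ler_wpM2r ?invr_ge0// lerDl.
apply: (le_trans (yM n)).
apply: (@le_trans _ _ (M / n.+1%:R ^+ 2 * (2 * n.+1%:R * q * c n.+1) ^+ 2)).
  rewrite ler_peMr ?divr_ge0 ?sqr_ge0//.
  exact: exprn_ege1.
rewrite (_ : _ * _ = M * (2 * q) ^+ 2 * c n.+1 ^+ 2); last first.
  by field; rewrite gt_eqF.
by rewrite ler_wpM2r ?sqr_ge0// lerDr.
Qed.

(** * Comparison with the population size and almost sure limit *)

Let A n k := iter k (average m) (C n).

Lemma admissible_A n k : admissible (A n k).
Proof. by apply: admissible_iter; exact: admissible_cond. Qed.

Lemma ex_A n k : ex (A n k) = (c n)%:E.
Proof.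
elim: k => [|k IHk]; first exact: ex_cond.
by apply: ex_av => //; exact: admissible_A.
Qed.

Lemma average_le (f1 f2 : (idx -> R) -> R) w :
  (forall i, f1 (subtree i w) <= f2 (subtree i w)) ->
  average m f1 w <= average m f2 w.
Proof.
move=> f12; apply: ler_wpM2l; first by rewrite invr_ge0 ltW.
by apply: ler_sum => i _; exact: f12.
Qed.

(** Shorting the edges of the first [k] levels can only raise the conductance. *)
Lemma cond_le_A n k w : C (k + n) w <= A n k w.
Proof.
elim: k w => [|k IHk] w //.
by apply: average_le => i; exact: le_trans (g_le _ _) (IHk _).
Qed.

Lemma ex_gap n k :
  ex (fun w => A n k w - C (k + n) w) = (c n - c (k + n))%:E.
Proof.
have aC := admissible_cond (k + n); have aA := admissible_A n k.
have aD : admissible (fun w => A n k w - C (k + n) w).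
  split => [|w]; last by rewrite subr_ge0 cond_le_A.
  by apply: measurable_funB; [exact: aA.1|exact: aC.1].
have := ex_lin aD aC ler01 ler01; rewrite !mul1e ex_cond.
under eq_integral => w _ do rewrite !mul1r subrK.
by rewrite ex_A EFinB => ->; rewrite addeK.
Qed.

(** Track the three second moments of [A] and [S]. In the quadratic form the off-diagonal
    contributions [B c^2 - 2 B c^2 + B c^2] cancel, [A] and [c * S] having the same mean, so each
    level contributes just a factor [1 / m]. *)
Lemma ex_square_gap n k : ex (fun w => (A n.+1 k w - c n.+1 * S k w) ^+ 2) =
  (m ^- k * (y n - c n.+1 ^+ 2))%:E.
Proof.
have [a1 [a2 [a3 [Aa1 Aa2 Aa3 aE]]]] : exists a1 a2 a3,
    [/\ ex (A n.+1 k \* A n.+1 k) = a1%:E, ex (A n.+1 k \* S k) = a2%:E,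
        ex (S k \* S k) = a3%:E &
    a1 - 2 * c n.+1 * a2 + c n.+1 ^+ 2 * a3 = m ^- k * (y n - c n.+1 ^+ 2)].
  elim: k => [|k [a1 [a2 [a3 [Aa1 Aa2 Aa3 aE]]]]].
    exists (y n), (c n.+1), 1; split; first exact: (ex_cond2 n).1.
    - by rewrite -ex_cond; apply: eq_integral => w _; rewrite /= mulr1.
    - by rewrite -ex_cst; apply: eq_integral => w _; rewrite /= mulr1.
    - by rewrite expr0 invr1; ring.
  have aA := admissible_A n.+1 k; have aS := admissible_S k.
  exists (m^-1 * a1 + B * (c n.+1 * c n.+1)), (m^-1 * a2 + B * (c n.+1 * 1)),
    (m^-1 * a3 + B * (1 * 1)); split.
  - exact: (ex_avM aA aA (ex_A _ _) (ex_A _ _) Aa1).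
  - exact: (ex_avM aA aS (ex_A _ _) (ex_S _) Aa2).
  - exact: (ex_avM aS aS (ex_S _) (ex_S _) Aa3).
  transitivity (m^-1 * (a1 - 2 * c n.+1 * a2 + c n.+1 ^+ 2 * a3)); first by ring.
  by rewrite aE mulrA -invfM -exprS.
have aA := admissible_A n.+1 k; have aS := admissible_S k.
have c0 := ltW (c_gt0 n.+1).
have aD : admissible (fun w => (A n.+1 k w - c n.+1 * S k w) ^+ 2).
  split => [|w]; last exact: sqr_ge0.
  apply: (@measurable_funX _ (cylT setT) _ setT (fun w => A n.+1 k w - c n.+1 * S k w)).
  apply: measurable_funB; first exact: aA.1.
  exact: (admissibleZ c0 aS).1.
have c20 : 0 <= 2 * c n.+1 by rewrite mulr_ge0.
have := ex_lin aD (admissibleM aA aS) ler01 c20.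
have := ex_lin (admissibleM aA aA) (admissibleM aS aS) ler01 (sqr_ge0 (c n.+1)).
rewrite Aa1 Aa2 Aa3 !mul1e => h1 h2; move: h2.
rewrite (_ : (\int[P]_w _)%E = (a1%:E + (c n.+1 ^+ 2)%:E * a3%:E)%E); last first.
  by rewrite -h1; apply: eq_integral => w _; congr EFin => /=; ring.
rewrite -aE -!EFinM -!EFinD => h.
rewrite -[LHS](@addeK _ (2 * c n.+1 * a2)%:E _)// -h -EFinB; congr EFin; ring.
Qed.

Lemma cond_noninc n (w : idx -> R) : (forall u, 0 < w (inr u)) ->
  C n.+1 w <= C n w.
Proof.
elim: n w => [|n IHn] w w0.
  apply: (@average_le (g 0) (fun v => (edge v)^-1)) => i.
  have : 0 < edge (subtree i w) by rewrite normr_gt0 gt_eqF// w0.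
  have : 0 <= C 0 (subtree i w) by exact: cond_ge0.
  rewrite /g; move: (C 0 _) (edge _) => x z x0 z0.
  have k0 : 0 < 1 + z * x by rewrite ltr_pwDl// mulr_ge0// ltW.
  by rewrite ler_pdivrMr// mulrDr mulr1 mulrA mulVf ?gt_eqF// mul1r lerDr invr_ge0 ltW.
apply: (@average_le (g n.+1) (g n)) => i; rewrite /g.
have e0 : 0 < edge (subtree i w) by rewrite normr_gt0 gt_eqF// w0.
have := IHn (subtree i w) (fun u => w0 (rcons u i)).
have := cond_ge0 n.+1 (subtree i w) m0; move: e0.
rewrite -/(C n.+1); move: (C n _) (C n.+1 _) (edge _) => x x' z z0 x'0 xx'.
have x0 := le_trans x'0 xx'.
have k0 : 0 < 1 + z * x by rewrite ltr_pwDl// mulr_ge0// ltW.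
have k'0 : 0 < 1 + z * x' by rewrite ltr_pwDl// mulr_ge0// ltW.
rewrite -subr_ge0.
rewrite (_ : _ - _ = (x - x') / ((1 + z * x) * (1 + z * x'))).
  by rewrite divr_ge0 ?subr_ge0// mulr_ge0// ltW.
by field; rewrite !gt_eqF.
Qed.

(** Adds up [j] successive drops; each is at most [K / (n + 1) * c (n + 1)], since [c] is
    nonincreasing and the indices only grow. *)
Lemma c_ratio (K : R) : 0 <= K ->
  (forall n, c n.+1 - c n.+2 <= K / n.+1%:R * c n.+1) ->
  forall n j, 1 - j%:R * K / n.+1%:R <= c (j + n.+1) / c n.+1 <= 1.
Proof.
move=> K0 HK n j; have c0 := c_gt0 n.+1; have n0 : 0 < n.+1%:R :> R by [].
suff [h1 h2] : c n.+1 - c (j + n.+1) <= j%:R * (K / n.+1%:R) * c n.+1 /\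
    c (j + n.+1) <= c n.+1.
  rewrite ler_pdivlMr// ler_pdivrMr// mul1r h2 andbT mulrBl mul1r.
  by rewrite lerBlDr -lerBlDl -(mulrA j%:R).
elim: j => [|j [h1 h2]]; first by rewrite subrr !mul0r.
split; last by rewrite addSn (le_trans (c_noninc _)).
have hj : c (j + n.+1) - c (j.+1 + n.+1) <= K / n.+1%:R * c n.+1.
  rewrite addSn addnS; apply: le_trans (HK (j + n)) _.
  apply: ler_pM => //; last by rewrite -addnS.
  - by rewrite divr_ge0.
  - exact/ltW/c_gt0.
  - by rewrite ler_wpM2l// lef_pV2 ?posrE// ler_nat ltnS leq_addl.
rewrite -natr1 2!mulrDl mul1r; have := lerD h1 hj.
by rewrite addrA subrK.
Qed.

Lemma cond_ratio_cvg (W : T -> R) :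
  {ae P, forall w, (fun k => S k (sample X w)) @ \oo --> W w} ->
  {ae P, forall w, (fun n => C n (sample X w) / c n) @ \oo --> W w}.
Proof.
move=> SW; have [K K0 HK] := drop_moment_bound.
have ratio := c_ratio K0 (fun n => (HK n).1).
(* The second-moment bounds concern [C n.+1], so the cube is written as a successor. *)
pose r k := (k.+1 ^ 3).-1.
have rE k : (r k).+1 = (k.+1 ^ 3)%N by rewrite prednK// expn_gt0.
pose N k := (k + (r k).+1)%N.
pose U k w := (A (r k).+1 k (sample X w) - C (N k) (sample X w)) / c (r k).+1.
pose V k w := (A (r k).+1 k (sample X w) / c (r k).+1 - S k (sample X w)) ^+ 2.
have mA k : measurable_fun setT (fun w => A (r k).+1 k (sample X w)).
  by apply/measurable_EFinP; exact: (measurable_EFin_sample (admissible_A _ _)).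
have mC k : measurable_fun setT (fun w => C k (sample X w)).
  by apply/measurable_EFinP; exact: (measurable_EFin_sample (admissible_cond _)).
have mS k : measurable_fun setT (fun w => S k (sample X w)).
  by apply/measurable_EFinP; exact: (measurable_EFin_sample (admissible_S _)).
have mgap k : measurable_fun setT
    (fun w => A (r k).+1 k (sample X w) - C (N k) (sample X w)).
  exact: measurable_funB.
have U0 : {ae P, forall w, (fun k => U k w) @ \oo --> (0 : R)}.
  (* A telescoping majorant: [k / (k + 1)^3 <= 1 / ((k + 1) (k + 2))]. *)
  apply: (@ae_cvg0 _ _ _ P U (fun k => K * (k.+1%:R^-1 - k.+2%:R^-1)) K).
  - by move=> k; exact: measurable_funM.
  - by move=> k w; rewrite divr_ge0 ?subr_ge0 ?cond_le_A// ltW// c_gt0.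
  - move=> k; have c0 := c_gt0 (r k).+1.
    under eq_integral => w _ do rewrite /U mulrC EFinM.
    rewrite ge0_integralZl//; last 3 first.
    + exact/measurable_EFinP.
    + by move=> w _; rewrite lee_fin subr_ge0 cond_le_A.
    + by rewrite lee_fin invr_ge0 ltW.
    rewrite ex_gap -EFinM lee_fin.
    have /andP[h _] := ratio (r k) k.
    apply: (@le_trans _ _ (k%:R * K / (r k).+1%:R)).
      rewrite mulrBr mulVf ?gt_eqF// [X in _ - X]mulrC lerBlDr -lerBlDl.
      exact: h.
    rewrite rE natrX -[k.+2%:R]natr1 -[k.+1%:R]natr1.
    have k0 := ler0n R k; have k1 : 0 < k%:R + 1 :> R by rewrite ltr_wpDl.
    have k2 : 0 < k%:R + 1 + 1 :> R by rewrite addr_gt0.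
    rewrite ler_pdivrMr ?exprn_gt0//.
    rewrite (_ : K * _ * _ = K * ((k%:R + 1) ^+ 2 / (k%:R + 1 + 1))); last first.
      by field; rewrite !gt_eqF.
    by rewrite mulrC ler_wpM2l// ler_pdivlMr//; nra.
  - move=> n; rewrite -mulr_sumr.
    have -> : \sum_(k < n) (k.+1%:R^-1 - k.+2%:R^-1) = 1 - n.+1%:R^-1 :> R.
      elim: n => [|n IHn]; first by rewrite big_ord0 invr1 subrr.
      by rewrite big_ord_recr /= IHn addrA subrK.
    by rewrite ler_piMr// gerBl invr_ge0.
have V0 : {ae P, forall w, (fun k => V k w) @ \oo --> (0 : R)}.
  apply: (@ae_cvg0 _ _ _ P V (fun k => K * m ^- k) (K / (1 - m^-1))).
  - move=> k; apply: measurable_funX; apply: measurable_funB => //.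
    exact: measurable_funM.
  - by move=> k w; exact: sqr_ge0.
  - move=> k; have c0 := c_gt0 (r k).+1.
    rewrite (_ : (\int[P]_w _)%E = (\int[P]_w ((c (r k).+1 ^- 2)%:E *
        ((A (r k).+1 k (sample X w) - c (r k).+1 * S k (sample X w)) ^+ 2)%:E))%E);
      last first.
      apply: eq_integral => w _; rewrite -EFinM; congr EFin; rewrite /V.
      by field; rewrite gt_eqF.
    rewrite ge0_integralZl//; last 3 first.
    + apply/measurable_EFinP; apply: measurable_funX; apply: measurable_funB => //.
      exact: measurable_funM.
    + by move=> w _; rewrite lee_fin sqr_ge0.
    + by rewrite lee_fin invr_ge0 sqr_ge0.
    rewrite ex_square_gap -EFinM lee_fin mulrCA mulrC.
    apply: ler_wpM2r; first by rewrite invr_ge0 exprn_ge0// ltW.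
    rewrite mulrC ler_pdivrMr ?exprn_gt0//.
    have [_ h] := HK (r k); apply: le_trans h.
    by rewrite gerBl sqr_ge0.
  - move=> n; rewrite -mulr_sumr ler_wpM2l//.
    rewrite -[X in _ <= X]div1r ler_pdivlMr//.
    have -> : (\sum_(k < n) m ^- k) * (1 - m^-1) = 1 - m ^- n.
      elim: n => [|n IHn]; first by rewrite big_ord0 mul0r expr0 invr1 subrr.
      rewrite big_ord_recr /= mulrDl IHn exprS invfM; ring.
    by rewrite gerBl invr_ge0 exprn_ge0// ltW.
near=> w.
have U0w : (fun k => U k w) @ \oo --> (0 : R) by near: w.
have V0w : (fun k => V k w) @ \oo --> (0 : R) by near: w.
have SWw : (fun k => S k (sample X w)) @ \oo --> W w by near: w.
have hK (L : R) : (fun k => 1 - L / k.+1%:R) @ \oo --> (1 : R).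
  rewrite -[X in _ --> X]subr0 -(mulr0 L); apply: cvgB; first exact: cvg_cst.
  by apply: cvgM; [exact: cvg_cst|exact: cvg_harmonic].
have k0 k := ler0n R k.
have X1 : (fun k => C (N k) (sample X w) / c (r k).+1) @ \oo --> W w.
  rewrite (_ : (fun _ => _) = (fun k => (A (r k).+1 k (sample X w) / c (r k).+1 -
      S k (sample X w)) + S k (sample X w) - U k w)); last first.
    by apply/funext => k; rewrite /U subrK mulrBl opprB addrC subrK.
  rewrite -[W w]subr0 -[W w]add0r; apply: cvgB => //; apply: cvgD => //.
  exact: squares_cvg0.
(* Replaces the normalization at depth index [(r k).+1] by the one at [N k]. *)
have c1 : (fun k => c (N k) / c (r k).+1) @ \oo --> (1 : R).
  apply: (@squeeze_cvgr _ _ _ _ (fun k => 1 - K / k.+1%:R) (fun=> 1)) => //;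
    last exact: cvg_cst.
  apply: nearW => k; have /andP[h ->] := ratio (r k) k; rewrite andbT.
  apply: le_trans h; rewrite lerD2l lerN2 mulrAC mulrC ler_wpM2l// rE natrX.
  rewrite -[k.+1%:R]natr1 ler_pdivrMr ?exprn_gt0 ?ltr_wpDl//.
  rewrite exprS mulrA mulVf ?mul1r ?gt_eqF ?ltr_wpDl//.
  by have := k0 k; nra.
apply: (@ratio_subseq_cvg _ (fun n => C n (sample X w)) c N).
- by move=> n; exact: cond_ge0.
- by move=> n; apply: cond_noninc => u; exact: X_inr_gt0.
- exact: c_gt0.
- exact: c_noninc.
- by move=> k; rewrite /N !rE; nia.
- rewrite (_ : (fun _ => _) = (fun k => C (N k) (sample X w) / c (r k).+1 *
      (c (N k) / c (r k).+1)^-1)); last first.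
    apply/funext => k; have := c_gt0 (N k); have := c_gt0 (r k).+1.
    by move=> ? ?; field; rewrite !gt_eqF.
  rewrite -[W w]mulr1 -[1]invr1; apply: cvgM => //.
  by apply: cvgV => //; exact: oner_neq0.
- apply: (@squeeze_cvgr _ _ _ _ (fun k => 1 - (8 * K) / k.+1%:R) (fun=> 1)) => //;
    last exact: cvg_cst.
  apply: nearW => k.
  (* The gap is quadratic while [N k] is cubic, so the relative gap is [O(1 / k)]; the constant 8 is
     attained at [k = 0]. *)
  have Nk : (N k.+1 = (3 * k ^ 2 + 9 * k + 8) + (k + r k).+1)%N.
    by rewrite -addnS /N !rE; nia.
  have NkE : N k = (k + r k).+1 by rewrite /N addnS.
  have := ratio (k + r k)%N (3 * k ^ 2 + 9 * k + 8)%N.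
  rewrite -Nk -NkE => /andP[h ->]; rewrite andbT; apply: le_trans h.
  set j := (3 * k ^ 2 + 9 * k + 8)%N.
  have hj : j%:R * k.+1%:R <= 8 * (N k)%:R :> R.
    by rewrite -!natrM ler_nat /j /N rE; nia.
  have Nk0 : 0 < (N k)%:R :> R by rewrite NkE ltr0n.
  have k10 : 0 < k.+1%:R :> R by rewrite ltr0n.
  rewrite lerD2l lerN2 (mulrC j%:R) (mulrC 8) -!mulrA ler_wpM2l//.
  by rewrite ler_pdivrMr// mulrAC ler_pdivlMr.
Unshelve. all: by end_near.
Qed.

End conductance_moments.

(** * Transfer to the given network *)

Lemma size_level {R : realType} (m : R) n (w : idx -> R) : m != 0 ->
  (size (level (network_N w) n))%:R / m ^+ n =
  iter n (average m) (fun=> 1 : R) w.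
Proof.
move=> m0; have sizeE (s : seq (seq nat)) : (size s)%:R = \sum_(u <- s) (1 : R).
  by elim: s => [|u s IHs]; rewrite ?big_nil// big_cons -IHs /= -natr1 addrC.
elim: n w => [|n IHn] w; first by rewrite expr0 divr1.
rewrite sizeE big_level_branch exprS invfM mulrCA iterS /average.
congr (_ * _); rewrite mulr_suml; apply: eq_bigr => i _.
by rewrite -IHn sizeE.
Qed.

Theorem theorem1p1 (R : realType) (d : measure_display) (T : measurableType d)
  (P : probability T R)
  (p : nat -> R) (m : R)
  (N : seq nat -> T -> nat)   (* N u w = number of children of vertex u *)
  (xi : seq nat -> T -> R)    (* xi u w = xi(e) for the edge e = {parent u, u} *)
  (W : T -> R) :
  (forall u, measurable_fun setT (N u)) ->
  (forall u, measurable_fun setT (xi u)) ->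
  (* offspring distribution p, with p_0 = 0 and finite mean m > 1 *)
  (forall u k, P (N u @^-1` [set k]) = (p k)%:E) ->
  p 0 = 0 ->
  (fun n => \sum_(k < n) (k%:R * p k)) @ \oo --> m ->
  1 < m ->
  (* the xi(e) are identically distributed, strictly positive *)
  (forall u v (B : set R), measurable B ->
     P (xi u @^-1` B) = P (xi v @^-1` B)) ->
  (forall u w, 0 < xi u w) ->
  (* all the N u and xi v are mutually independent *)
  mutually_independent P
    (fun i : seq nat + seq nat => fun w =>
       match i with inl u => (N u w)%:R | inr u => xi u w end) ->
  (* E[xi + xi^-1 + nu^2] < oo *)
  ('E_P[(fun w => xi [:: 0%N] w + (xi [:: 0%N] w)^-1 + ((N [::] w)%:R) ^+ 2)%R]
     < +oo)%E ->
  (* W is the a.s. limit of m^-n #T_n *)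
  {ae P, forall w,
     (fun n => (size (level (N^~ w) n))%:R / m ^+ n) @ \oo --> W w} ->
  let C := fun n w =>
    eff_conductance (N^~ w) (fun u => (m ^+ size u * xi u w)^-1) n in
  (forall n, 'E_P[C n] \is a fin_num)%E /\
  {ae P, forall w, (fun n => C n w / fine 'E_P[C n]) @ \oo --> W w}.
Proof.
move=> mN mxi hp p0 pm m1 hxi xi0 iX hE WL C.
have m0 : 0 < m := lt_trans ltr01 m1.
pose X (i : idx) (w : T) : R :=
  match i with inl u => (N u w)%:R | inr u => xi u w end.
have mfN u (f : nat -> R) : measurable_fun setT (fun w => f (N u w)).
  move=> _ B mB; have := mN u measurableT (f @^-1` B) I.
  by rewrite !setTI.
have mX i : measurable_fun setT (X i).
  case: i => u; last exact: mxi.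
  exact: (mfN u (fun k => k%:R)).
have X_inl u v B : measurable B ->
    P (X (inl u) @^-1` B) = P (X (inl v) @^-1` B).
  move=> mB.
  (* Point masses determine the law: the preimage of [B] is a countable disjoint union of events
     [N v' = k]. *)
  have PE v' : P (X (inl v') @^-1` B) =
      (\sum_(k <oo) if k%:R \in B then (p k)%:E else 0)%E.
    pose F k := if k%:R \in B then N v' @^-1` [set k] else set0.
    have mF k : measurable (F k).
      rewrite /F; case: ifP => // _.
      by rewrite -[X in measurable X]setTI; exact: mN.
    rewrite (_ : _ @^-1` B = \bigcup_k F k); last first.
      apply/seteqP; split => w.
        by move=> Bw; exists (N v' w) => //; rewrite /F mem_set.
      by move=> [k _]; rewrite /F; case: ifPn => //; rewrite inE => Bk /= Nk; rewrite Nk.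
    have tF : trivIset setT F.
      apply/trivIsetP => i j _ _ ij; apply/seteqP; split => // w [].
      rewrite /F; case: ifP => // _; case: ifP => // _ /= -> ji.
      by rewrite ji eqxx in ij.
    rewrite measure_semi_bigcup//; last exact: bigcup_measurable.
    by apply: eq_eseriesr => k _; rewrite /F; case: ifP => _; [exact: hp|exact: measure0].
  by rewrite !PE.
have X_inr u v B : measurable B ->
    P (X (inr u) @^-1` B) = P (X (inr v) @^-1` B) by exact: hxi.
have nuE w : nu (sample X w) = N [::] w by rewrite /nu /= natrK.
have p_nu k : P [set w | nu (sample X w) = k] = (p k)%:E.
  by rewrite -(hp [::]); congr (P _); apply/seteqP; split => w /=; rewrite nuE.
have p_ge0 k : 0 <= p k by rewrite -lee_fin -p_nu measure_ge0.
have mean1 : (\sum_(k <oo) (k%:R * p k)%:E = m%:E)%E.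
  apply/cvg_lim => //.
  rewrite (_ : (fun _ => _) = EFin \o (fun n => \sum_(k < n) (k%:R * p k))).
    by apply/fine_cvgP; split; [exact: nearW|exact: pm].
  by apply/funext => n; rewrite big_mkord sumEFin.
have Eall : (\int[P]_w (xi [:: 0%N] w + (xi [:: 0%N] w)^-1 + (N [::] w)%:R ^+ 2)%:E < +oo)%E.
  by move: hE; rewrite unlock.
have mxi0 : measurable_fun setT (xi [:: 0%N]) := mxi _.
have fin_of (f : T -> R) : measurable_fun setT f -> (forall w, 0 <= f w) ->
    (forall w, f w <= xi [:: 0%N] w + (xi [:: 0%N] w)^-1 + (N [::] w)%:R ^+ 2) ->
    exists r, (\int[P]_w (f w)%:E)%E = r%:E.
  move=> mf f0 fle; exists (fine (\int[P]_w (f w)%:E)%E); rewrite fineK//.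
  rewrite ge0_fin_numE; last by apply: integral_ge0 => w _; rewrite lee_fin.
  apply: le_lt_trans Eall; apply: ge0_le_integral => //.
  - by move=> w _; rewrite lee_fin.
  - exact/measurable_EFinP.
  - apply/measurable_EFinP; apply: measurable_funD.
      apply: measurable_funD => //; apply: measurable_inv => // w.
      exact/ltW/xi0.
    by apply: measurable_funX; exact: (mX (inl [::])).
  - by move=> w _; rewrite lee_fin.
have pos3 w : [/\ 0 <= xi [:: 0%N] w, 0 <= (xi [:: 0%N] w)^-1 &
    0 <= (N [::] w)%:R ^+ 2 :> R].
  by rewrite invr_ge0 sqr_ge0 ltW.
have [e eE] : exists e, (\int[P]_w (xi [:: 0%N] w)%:E)%E = e%:E.
  by apply: fin_of => // w; have [] := pos3 w; lra.
have [a aE] : exists a, (\int[P]_w ((xi [:: 0%N] w)^-1)%:E)%E = a%:E.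
  apply: fin_of => [|w|w]; [|by rewrite invr_ge0 ltW|by have [] := pos3 w; lra].
  by apply: measurable_inv => // w; exact/ltW/xi0.
have [b bE] : exists b, (\int[P]_w ((N [::] w * (N [::] w).-1)%:R)%:E)%E = b%:E.
  apply: fin_of => // [|w].
    exact: (mfN [::] (fun k => (k * k.-1)%:R)).
  have [h1 h2 _] := pos3 w; rewrite -natrX.
  have : (N [::] w * (N [::] w).-1)%:R <= (N [::] w ^ 2)%:R :> R by rewrite ler_nat; nia.
  by lra.
have mean2 : (\sum_(k <oo) ((k * k.-1)%:R * p k)%:E = b%:E)%E.
  (* The factorial moment as a mixture over [nu], with the constant functionals [k (k - 1)]. *)
  transitivity (\sum_(k <oo) (p k)%:E * \int[P]_w ((k * k.-1)%:R)%:E)%E.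
    apply: eq_eseriesr => k _.
    by rewrite (ex_cst P X (k * k.-1)%:R) -EFinM mulrC.
  rewrite -bE.
  rewrite -(@ex_nu_dep _ _ _ P X p mX iX p_nu (fun k _ => (k * k.-1)%:R))//.
  by apply: eq_integral => w _; rewrite nuE.
have exedge : (\int[P]_w (edge (sample X w))%:E = e%:E)%E.
  (* The moment hypothesis is about the edge above [[:: 0]], while [edge] reads [inr [::]]; passing
     to branch 0 identifies the two. *)
  rewrite -eE -(ex_subtree mX iX X_inl X_inr 0)//; last 2 first.
  - exact: (admissible_edge).1.
  - exact: edge_ge0.
  by apply: eq_integral => w _; rewrite /edge gtr0_norm //; exact: xi0.
have exinv : (\int[P]_w ((edge (sample X w))^-1)%:E = a%:E)%E.
  rewrite -aE -(ex_subtree mX iX X_inl X_inr 0 (f := fun v => (edge v)^-1)); last 2 first.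
  - exact: (admissibleV admissible_edge).1.
  - by move=> w; rewrite invr_ge0 edge_ge0.
  by apply: eq_integral => w _; rewrite /edge gtr0_norm //; exact: xi0.
have NE w : network_N (sample X w) = N^~ w.
  by apply/funext => u; rewrite /network_N /= natrK.
have CE n w : C n.+1 w = cond m n (sample X w).
  rewrite -(eff_conductance_cond n m0 (fun u => xi0 u w)) NE.
  congr eff_conductance.
  by apply/funext => u; rewrite /network_c div1r.
(* At depth 0 the root would need both potentials 1 and 0: no potential is admissible, and the
   infimum of the empty set is 0. *)
have C0 w : C 0 w = 0.
  rewrite /C /eff_conductance (_ : [set energy _ _ _ _ | _ in _] = set0) ?inf0//.
  apply/seteqP; split => // x [f [f1 f0] _].
  by move: (f0 [::]); rewrite /= inE eqxx f1 => /(_ isT)/eqP; rewrite oner_eq0.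
have exC n : 'E_P[C n.+1]%E = (\int[P]_w (cond m n (sample X w))%:E)%E.
  by rewrite unlock; apply: eq_integral => w _; rewrite CE.
split.
  case=> [|n].
    by rewrite unlock integral0_eq// => w _; rewrite C0.
  rewrite exC (ex_cond mX iX X_inl X_inr p_nu m1 mean1 mean2 exinv)//.
have SW : {ae P, forall w,
    (fun k => iter k (average m) (fun=> 1) (sample X w)) @ \oo --> W w}.
  apply: filterS WL => w; rewrite [X in _ -> X @ _ --> _](_ : _ =
    (fun n => (size (level (N^~ w) n))%:R / m ^+ n))//.
  by apply/funext => n; rewrite -size_level ?gt_eqF// NE.
have := cond_ratio_cvg mX iX X_inl X_inr _ p_nu m1 mean1 mean2 exedge exinv SW.
move=> /(_ (fun u w => xi0 u w)); apply: filterS => w h.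
(* [cond m n] is the conductance to depth [n.+1], so the limit is taken along the shifted
   sequence. *)
rewrite -(cvg_shiftS (fun n => C n w / fine 'E_P[C n]%E)).
rewrite [X in X @ _ --> _](_ : _ = (fun n => cond m n (sample X w) /
  fine (\int[P]_w (cond m n (sample X w))%:E)%E))//.
by apply/funext => n; rewrite -exC -CE.
Qed.
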